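(* For every fixed constant $n\ge 2$, the decision problem \textsc{Reformability}, restricted to instances with exactly $n$ agents having binary utilities, is in P.
   Context: Let $N=\{1,\dots,n\}$ be a set of $n\ge 2$ agents and $M$ a set of $m\ge 1$ indivisible goods. Each agent $i$ has an additive utility function $u_i:2^M\to\mathbb{R}_{\ge 0}$, i.e., $u_i(M')=\sum_{g\in M'}u_i(\{g\})$. An instance consists of $N$, $M$ and $(u_i)_{i\in N}$. Utilities are binary if $u_i(\{g\})\in\{0,1\}$ for all $i\in N$, $g\in M$. An allocation $\mathcal{A}=(A_1,\dots,A_n)$ is an ordered partition of $M$ into $n$ (possibly empty) bundles, $A_i$ going to agent $i$. A size vector is $\vec{s}=(s_1,\dots,s_n)$ with non-negative integer entries and $\sum_i s_i=m$; $\mathcal{A}$ has size vector $\vec{s}$ if $|A_i|=s_i$ for all $i$. Agent $i$ is EF1 towards agent $j$ in $\mathcal{A}$ if $A_j=\varnothing$ or there exists $g\in A_j$ with $u_i(A_i)\ge u_i(A_j\setminus\{g\})$. $\mathcal{A}$ is EF1 if every agent is EF1 towards every other agent. \textsc{Reformability}: given an instance (utilities listed good by good for each agent) and a size vector $\vec{s}$, decide whether there exists an EF1 allocation with size vector $\vec{s}$. *)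

(* Defs.v *)
From HB Require Import structures.
From mathcomp Require Import all_boot all_order all_algebra.
From mathcomp Require Import reals.

Set Implicit Arguments.
Unset Strict Implicit.
Unset Printing Implicit Defensive.

Import Order.TTheory GRing.Theory Num.Theory.
Local Open Scope ring_scope.

(** Two-way infinite tape: [tleft] lists the cells to the left of the head,
    nearest first; cells outside the three fields are blank. *)
Record tape (G : Type) := Tape { tleft : seq G; thead : G; tright : seq G }.

Inductive move := MoveLeft | Stay | MoveRight.

Definition tape_write (G : Type) (a : G) (t : tape G) : tape G :=
  Tape (tleft t) a (tright t).

Definition tape_move (G : Type) (blank : G) (d : move) (t : tape G) : tape G :=
  match d with
  | MoveLeft => Tape (behead (tleft t)) (head blank (tleft t))
                     (thead t :: tright t)
  | Stay => t
  | MoveRight => Tape (thead t :: tleft t) (head blank (tright t))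
                      (behead (tright t))
  end.

(** The tapes are indexed by a nonempty finite type [tm_tape], of which
    [tm_input] initially carries the input. *)
Record TM (Sigma : finType) := {
  tm_state : finType;
  tm_sym : finType;
  tm_tape : finType;
  tm_input : tm_tape;
  tm_blank : tm_sym;
  tm_in : Sigma -> tm_sym;
  tm_in_inj : injective tm_in;
  tm_in_blank : forall a, tm_in a != tm_blank;
  tm_start : tm_state;
  tm_accept : tm_state;
  tm_reject : tm_state;
  tm_accept_reject : tm_accept != tm_reject;
  tm_delta : tm_state -> {ffun tm_tape -> tm_sym} ->
             tm_state * {ffun tm_tape -> tm_sym * move}
}.

Record config (Sigma : finType) (T : TM Sigma) := Config {
  cstate : tm_state T;
  ctapes : {ffun tm_tape T -> tape (tm_sym T)}
}.

Definition halted (Sigma : finType) (T : TM Sigma) (c : config T) : bool :=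
  (cstate c == tm_accept T) || (cstate c == tm_reject T).

Definition tm_step (Sigma : finType) (T : TM Sigma) (c : config T) : config T :=
  if halted c then c else
  let: (q, act) := tm_delta (cstate c) [ffun i => thead (ctapes c i)] in
  Config q [ffun i => tape_move (tm_blank T) (act i).2
                        (tape_write (act i).1 (ctapes c i))].

Definition tm_init (Sigma : finType) (T : TM Sigma) (w : seq Sigma) : config T :=
  let v := map (@tm_in _ T) w in
  Config (tm_start T)
    [ffun i => if i == tm_input T
               then Tape [::] (head (tm_blank T) v) (behead v)
               else Tape [::] (tm_blank T) [::]].

Definition tm_run (Sigma : finType) (T : TM Sigma) (t : nat) (w : seq Sigma) :
  config T := iter t (@tm_step _ T) (tm_init T w).

Definition language (Sigma : finType) := seq Sigma -> Prop.

Definition in_P (Sigma : finType) (L : language Sigma) : Prop :=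
  exists (T : TM Sigma) (p : {poly nat}), forall w : seq Sigma,
    exists t : nat,
      [/\ (t <= p.[size w])%N,
          halted (tm_run T t w)
        & cstate (tm_run T t w) = tm_accept T <-> L w].

(** An additive utility function is given by its values on single goods. *)
Record instance (R : realType) (n : nat) := Instance {
  goods : nat;
  goods_gt0 : (0 < goods)%N;
  value : 'I_n -> 'I_goods -> R;
  value_ge0 : forall i g, 0 <= value i g
}.

Definition utility (R : realType) (n : nat) (I : instance R n)
    (i : 'I_n) (S : {set 'I_(goods I)}) : R :=
  \sum_(g in S) value i g.

Definition binary (R : realType) (n : nat) (I : instance R n) : Prop :=
  forall (i : 'I_n) (g : 'I_(goods I)), value i g = 0 \/ value i g = 1.

Definition is_allocation (n m : nat) (A : {ffun 'I_n -> {set 'I_m}}) : Prop :=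
  (forall i j, i != j -> [disjoint A i & A j]) /\ \bigcup_i A i = [set: 'I_m].

Definition is_size_vector (n m : nat) (s : {ffun 'I_n -> nat}) : Prop :=
  (\sum_i s i)%N = m.

Definition has_size_vector (n m : nat) (A : {ffun 'I_n -> {set 'I_m}})
    (s : {ffun 'I_n -> nat}) : Prop :=
  forall i, #|A i| = s i.

Definition EF1_towards (R : realType) (n : nat) (I : instance R n)
    (A : {ffun 'I_n -> {set 'I_(goods I)}}) (i j : 'I_n) : Prop :=
  A j = set0 \/
  exists2 g, g \in A j & utility i (A i) >= utility i (A j :\ g).

Definition EF1 (R : realType) (n : nat) (I : instance R n)
    (A : {ffun 'I_n -> {set 'I_(goods I)}}) : Prop :=
  forall i j, i != j -> EF1_towards A i j.

Definition reformable (R : realType) (n : nat) (I : instance R n)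
    (s : {ffun 'I_n -> nat}) : Prop :=
  exists A : {ffun 'I_n -> {set 'I_(goods I)}},
    [/\ is_allocation A, has_size_vector A s & EF1 A].

(** Binary numeral without superfluous zeros, least significant bit first;
    [0] is written [[:: false]]. *)
Definition bits (k : nat) : seq bool :=
  mkseq (fun j => odd (k %/ 2 ^ j)) (trunc_log 2 k).+1.

(** Words over {0, 1, #}, with [None] playing the role of the separator #. *)
Definition symbol : finType := option bool.

Definition block (b : seq bool) : seq symbol := rcons (map Some b) None.

(** For a binary instance: the n rows of utilities, each listing the values
    of the m goods for one agent, then s_1, ..., s_n in binary. *)
Definition encode (R : realType) (n : nat) (I : instance R n)
    (s : {ffun 'I_n -> nat}) : seq symbol :=
  flatten [seq block [seq value i g == 1 | g <- enum 'I_(goods I)]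
          | i <- enum 'I_n] ++
  flatten [seq block (bits (s i)) | i <- enum 'I_n].

(** Words that encode no binary instance with n agents are no-inputs. *)
Definition binary_reformability (R : realType) (n : nat) : language symbol :=
  fun w => exists (I : instance R n) (s : {ffun 'I_n -> nat}),
    [/\ binary I, is_size_vector (goods I) s, w = encode I s & reformable I s].

(* Main.v *)
(** Goods on which all agents agree are interchangeable, so an allocation may be
    assumed to give every agent an interval of the goods of each of the 2^n
    types.  It is then described by polynomially bounded endpoints, one pair for
    each type and each agent, and there are only polynomially many choices of
    those.  That a choice of endpoints yields an EF1 allocation with the
    prescribed sizes is expressed by a formula over the positions of the input
    word, with bounded quantifiers, counting, and bounded recursion (the latter
    to read binary numerals).  Such a formula is evaluated in polynomial time by
    a one-tape machine which represents every variable by a mark on its own track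
    of the tape, and which only ever sweeps over the tape. *)

Require Import Defs.
From mathcomp Require Import all_boot all_order all_algebra.
From mathcomp Require Import reals.
From mathcomp Require Import zify.

Set Implicit Arguments.
Unset Strict Implicit.
Unset Printing Implicit Defensive.

(** * Machine fragments *)

(** Two facts make the formula small. With binary utilities, EF1 of [i] towards [j] only says that
    [i] desires at most one good more in the bundle of [j] than in its own, a comparison of two
    counts. And rearranging ownership within each type keeps, for every agent, the number of goods
    of each type, hence all bundle sizes and all those counts. A fixed [n] makes the number of
    variables constant, 1 + 4n + 2n * 2^n, counting the number of goods and the two ends of each of
    the 2n blocks; nested exhaustive search over so many marks is polynomial, with an exponent
    depending on [n]. Since the input may be any word, the formula also has to verify that it is an
    encoding: rows of equal length without separators, then canonical numerals equal to the bundle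
    sizes. The other burden is composing machines: a fragment starts and ends with the head on the
    first cell, and a predicate gives back the marks as it found them, so that it can be used inside
    branches and loops. *)

Section Fragments.

Variable cell : finType.

Record fragment := Fragment {
  fstate : finType;
  fstart : fstate;
  fstep : fstate -> option cell -> (fstate + bool) * (option cell * move)
}.

Inductive fruns (M : fragment) :
    fstate M -> tape (option cell) -> bool -> tape (option cell) -> nat -> Prop :=
| fruns_exit q (t : tape (option cell)) b a d :
    fstep q (Defs.thead t) = (inr b, (a, d)) ->
    fruns q t b (tape_move None d (tape_write a t)) 1
| fruns_next q (t : tape (option cell)) q' a d b t' k :
    fstep q (Defs.thead t) = (inl q', (a, d)) ->
    fruns q' (tape_move None d (tape_write a t)) b t' k -> fruns q t b t' k.+1.

Definition tape_at (l r : seq (option cell)) : tape (option cell) :=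
  Tape l (head None r) (behead r).

(* The head rests on the first cell; earlier excursions beyond either end leave
   explicit blanks in the representation of the tape. *)
Definition carries (x : seq cell) (t : tape (option cell)) : Prop :=
  exists a b, t = tape_at (nseq a None) (map Some x ++ nseq b None).

Definition spec (M : fragment) (x : seq cell) (e : bool) (y : seq cell)
    (T : nat) : Prop :=
  forall t, carries x t ->
  exists t' k, [/\ carries y t', k <= T & fruns (fstart M) t e t' k].

Lemma spec_leq M x e y T T' : T <= T' -> spec M x e y T -> spec M x e y T'.
Proof.
move=> leT sM t /sM[t' [k [yt' lek r]]].
by exists t', k; split=> //; apply: leq_trans leT.
Qed.

Section Cond.
Variables M A B : fragment.

Definition cond_step (q : fstate M + (fstate A + fstate B)) (c : option cell) :
    ((fstate M + (fstate A + fstate B)) + bool) * (option cell * move) :=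
  match q with
  | inl q => let: (r, act) := fstep q c in
    (inl match r with inl q' => inl q'
         | inr b => inr (if b then inl (fstart A) else inr (fstart B)) end, act)
  | inr (inl q) => let: (r, act) := fstep q c in
    (match r with inl q' => inl (inr (inl q')) | inr b => inr b end, act)
  | inr (inr q) => let: (r, act) := fstep q c in
    (match r with inl q' => inl (inr (inr q')) | inr b => inr b end, act)
  end.

Definition cond := Fragment (inl (fstart M)) cond_step.

Lemma cond_runs q t b t1 k1 e t2 k2 : @fruns M q t b t1 k1 ->
  fruns (fstart (if b then A else B)) t1 e t2 k2 ->
  @fruns cond (inl q) t e t2 (k1 + k2).
Proof.
have runA q' t' e' t'' k : @fruns A q' t' e' t'' k ->
    @fruns cond (inr (inl q')) t' e' t'' k.
  elim=> {q' t' e' t'' k} [q' t' b' a d E|q' t' r a d b' t'' k E _ IH].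
    by apply: fruns_exit; rewrite /= E.
  by apply: fruns_next IH; rewrite /= E.
have runB q' t' e' t'' k : @fruns B q' t' e' t'' k ->
    @fruns cond (inr (inr q')) t' e' t'' k.
  elim=> {q' t' e' t'' k} [q' t' b' a d E|q' t' r a d b' t'' k E _ IH].
    by apply: fruns_exit; rewrite /= E.
  by apply: fruns_next IH; rewrite /= E.
move=> r1; elim: r1 => {q t b t1 k1} [q t b a d E|q t q' a d b t' k E _ IH] r2.
  rewrite add1n.
  apply: (@fruns_next cond _ _ (inr (if b then inl (fstart A) else inr (fstart B)))).
    by rewrite /= E.
  by case: b r2 {E} => r2; [apply: runA | apply: runB].
by rewrite addSn; apply: fruns_next (IH r2); rewrite /= E.
Qed.

Lemma spec_cond x b y e z T1 T2 : spec M x b y T1 ->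
  spec (if b then A else B) y e z T2 -> spec cond x e z (T1 + T2).
Proof.
move=> sM sN t /sM[t1 [k1 [c1 le1 r1]]].
have [t2 [k2 [c2 le2 r2]]] := sN _ c1.
exists t2, (k1 + k2); split=> //; first exact: leq_add.
exact: cond_runs r1 r2.
Qed.

End Cond.

Section Loop.
Variable M : fragment.

Definition loop_step (q : fstate M) (c : option cell) :
    (fstate M + bool) * (option cell * move) :=
  let: (r, act) := fstep q c in
  (match r with
   | inl q' => inl q'
   | inr b => if b then inl (fstart M) else inr true
   end, act).

Definition loop := Fragment (fstart M) loop_step.

Lemma loop_again q t t1 k1 e t2 k2 : @fruns M q t true t1 k1 ->
  @fruns loop (fstart M) t1 e t2 k2 -> @fruns loop q t e t2 (k1 + k2).
Proof.
move: {2 3}true (erefl true) => b + r1.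
elim: r1 => {q t b t1 k1} [q t b a d E|q t q' a d b t' k E _ IH] eb r2.
  rewrite add1n; apply: fruns_next r2; by rewrite /= /loop_step E -eb.
by rewrite addSn; apply: fruns_next (IH eb r2); rewrite /= /loop_step E.
Qed.

Lemma loop_end q t t1 k1 : @fruns M q t false t1 k1 -> @fruns loop q t true t1 k1.
Proof.
move: {2 3}false (erefl false) => b + r1.
elim: r1 => {q t b t1 k1} [q t b a d E|q t q' a d b t' k E _ IH] eb.
  by apply: fruns_exit; rewrite /= /loop_step E -eb.
by apply: fruns_next (IH eb); rewrite /= /loop_step E.
Qed.

Lemma spec_loop (x : nat -> seq cell) (n T : nat) :
  (forall i, i < n -> spec M (x i) true (x i.+1) T) ->
  spec M (x n) false (x n) T -> spec loop (x 0) true (x n) (n.+1 * T).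
Proof.
elim: n x => [|n IH] x go stop.
  move=> t /stop[t1 [k [c1 le1 r1]]]; exists t1, k; rewrite mul1n; split=> //.
  exact: loop_end.
move=> t /(go 0 (ltn0Sn n))[t1 [k1 [c1 le1 r1]]].
have [|t2 [k2 [c2 le2 r2]]] := IH (fun i => x i.+1) _ stop t1 c1.
  by move=> i lt; apply: go.
exists t2, (k1 + k2); split=> //; first by rewrite mulSn leq_add.
exact: loop_again r1 r2.
Qed.

End Loop.

(** * Finite-state transducers as one pass to the right and a return *)

Section Sweep.
Variables (S : finType) (s0 : S) (delta : S -> cell -> S * cell) (out : S -> bool).

Fixpoint transduce (s : S) (x : seq cell) : S * seq cell :=
  if x is c :: x' then
    let: (s', c') := delta s c in
    let: (s'', y) := transduce s' x' in (s'', c' :: y)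
  else (s, [::]).

(** The states [inl] carry the transducer to the first blank, the states [inr] bring the exit bit
    back to the first cell; each blank met costs one extra step. *)
Definition sweep_step (q : S + bool) (c : option cell) :
    ((S + bool) + bool) * (option cell * move) :=
  match q, c with
  | inl s, Some c => let: (s', c') := delta s c in
      (inl (inl s'), (Some c', MoveRight))
  | inl s, None => (inl (inr (out s)), (None, MoveLeft))
  | inr b, Some c => (inl (inr b), (Some c, MoveLeft))
  | inr b, None => (inr b, (None, MoveRight))
  end.

Definition sweep := Fragment (inl s0) sweep_step.

Lemma sweep_back b l a r :
  exists a', @fruns sweep (inr b)
    (Tape (behead (map Some l ++ nseq a None)) (head None (map Some l ++ nseq a None)) r)
    b (tape_at (nseq a' None) (map Some (rev l) ++ r)) (size l).+1.
Proof.
elim: l r => [|c l IH] r /=.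
  (* [a.-1.+1] is the larger of [a] and 1: stepping over the left end turns an implicit blank into
     an explicit one. *)
  exists a.-1.+1; have -> : head None (nseq a (@None cell)) = None by case: a.
  have -> : behead (nseq a (@None cell)) = nseq a.-1 None by case: a.
  exact: (@fruns_exit sweep (inr b) (Tape _ None r) b None MoveRight (erefl _)).
have [a' run] := IH (Some c :: r).
exists a'; rewrite rev_cons map_rcons cat_rcons.
exact: (@fruns_next sweep _ _ (inr b) (Some c) MoveLeft).
Qed.

Lemma sweep_forth s x b l a :
  exists b', @fruns sweep (inl s)
    (tape_at (map Some l ++ nseq a None) (map Some x ++ nseq b None))
    (out (transduce s x).1)
    (tape_at (nseq b'.1 None)
       (map Some (rev l ++ (transduce s x).2) ++ nseq b'.2 None))
    (size x + size x + size l).+2.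
Proof.
elim: x s l => [|c x IH] s l /=.
  have [a' run] := sweep_back (out s) l a (None :: nseq b.-1 None).
  exists (a', b.-1.+1); rewrite cats0 add0n.
  have eb : tape_at (map Some l ++ nseq a None) (nseq b None) =
    Tape (map Some l ++ nseq a None) None (nseq b.-1 (@None cell)) by case: b {run}.
  rewrite eb.
  exact: (@fruns_next sweep _ _ (inr (out s)) None MoveLeft).
case E: (delta s c) => [s' c']; have [b' run] := IH s' (c' :: l).
case E': (transduce s' x) run => [s'' y] /= run; exists b'.
rewrite rev_cons cat_rcons /= addnS in run.
rewrite addnS !addSn.
apply: (@fruns_next sweep _ _ (inl s') (Some c') MoveRight); first by rewrite /= E.
exact: run.
Qed.

Lemma spec_sweep x : spec sweep x (out (transduce s0 x).1) (transduce s0 x).2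
  (size x + size x).+2.
Proof.
move=> t [a [b ->]].
have [b' run] := sweep_forth s0 x b [::] a.
eexists; exists (size x + size x).+2; split; [|by []|].
  2: by rewrite addn0 in run; exact: run.
by exists b'.1, b'.2.
Qed.

Lemma transduce_mkseq (st : nat -> S) (f g : nat -> cell) n :
  (forall p, p < n -> delta (st p) (f p) = (st p.+1, g p)) ->
  transduce (st 0) (mkseq f n) = (st n, mkseq g n).
Proof.
rewrite /mkseq; elim: n st f g => //= n IH st f g H.
rewrite H // -[1]add1n !iotaDl -!map_comp.
rewrite (IH (st \o succn) (f \o succn) (g \o succn)) //.
by move=> p lt; apply: H.
Qed.

End Sweep.

End Fragments.

(** * Tracks and sweeps *)

Definition polytime (T : nat -> nat) : Prop :=
  exists p : {poly nat}, forall N, T N <= p.[N]%R.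

Lemma polytime_cst c : polytime (fun=> c).
Proof. by exists c%:P%R => N; rewrite hornerC. Qed.

Lemma polytime_id : polytime id.
Proof. by exists 'X%R => N; rewrite hornerX. Qed.

Lemma polytimeD T U : polytime T -> polytime U -> polytime (fun N => T N + U N).
Proof.
move=> [p hp] [q hq]; exists (p + q)%R => N.
by rewrite hornerD; apply: leq_add.
Qed.

Lemma polytimeM T U : polytime T -> polytime U -> polytime (fun N => T N * U N).
Proof.
move=> [p hp] [q hq]; exists (p * q)%R => N.
by rewrite hornerM; apply: leq_mul.
Qed.

Definition cell (K : nat) : finType := (symbol * {ffun 'I_K -> bool})%type.

Definition enc_cell K (w : seq symbol) (e : seq nat) (p : nat) : cell K :=
  (nth None w p, [ffun v : 'I_K => nth (size w) e v == p]).

(* Track [v] carries a single mark, at the position [nth 0 e v]; the value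
   [size w], as well as an unused track, is represented by the absence of a
   mark. *)
Definition enc K (w : seq symbol) (e : seq nat) : seq (cell K) :=
  mkseq (enc_cell K w e) (size w).

Definition bounded (w : seq symbol) (e : seq nat) : bool :=
  all (fun v => v <= size w) e.

Lemma bounded_nth w e i : bounded w e -> nth 0 e i <= size w.
Proof.
move=> /allP be; case: (ltnP i (size e)) => h; last by rewrite nth_default.
by apply: be; apply: mem_nth.
Qed.

Lemma bounded_rcons w e v : bounded w (rcons e v) = (v <= size w) && bounded w e.
Proof. by rewrite /bounded all_rcons. Qed.

Lemma bounded_cat w e e' : bounded w (e ++ e') = bounded w e && bounded w e'.
Proof. exact: all_cat. Qed.

Lemma bounded_take w d e : bounded w e -> bounded w (take d e).
Proof.
by move=> /allP be; apply/allP => v /mem_take; apply: be.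
Qed.

(** One fragment serves all words, with a time bound depending on the length alone; choosing [M] and
    [T] before [w] is what finally yields a single Turing machine. *)
Definition realizes K d (f : seq symbol -> seq nat -> bool)
    (g : seq symbol -> seq nat -> seq nat) : Prop :=
  exists (M : fragment (cell K)) (T : nat -> nat), polytime T /\
    forall w e, size e = d -> bounded w e ->
      spec M (enc K w e) (f w e) (enc K w (g w e)) (T (size w)).

Section Realizes.
Variable K : nat.

Lemma realizes_ext d f g f' g' :
  (forall w e, size e = d -> bounded w e -> f w e = f' w e /\ g w e = g' w e) ->
  realizes K d f g -> realizes K d f' g'.
Proof.
move=> E [M [T [pT H]]]; exists M, T; split=> // w e se be.
by have [<- <-] := E w e se be; apply: H.
Qed.

(** [st] is a closed form for the state before cell [p], so a sweep is verified cell by cell,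
    without a new induction. *)
Lemma realizes_sweep d (S : finType) (s0 : S)
    (delta : S -> cell K -> S * cell K) (out : S -> bool)
    (st : seq symbol -> seq nat -> nat -> S) f g :
  (forall w e, size e = d -> bounded w e ->
     [/\ st w e 0 = s0, out (st w e (size w)) = f w e &
     forall p, p < size w ->
       delta (st w e p) (enc_cell K w e p) = (st w e p.+1, enc_cell K w (g w e) p)]) ->
  realizes K d f g.
Proof.
move=> H; exists (sweep s0 delta out), (fun N => N + N + 2); split.
  by apply: polytimeD; [apply: polytimeD; exact: polytime_id | exact: polytime_cst].
move=> w e se be; have [e0 eo es] := H w e se be.
have := @spec_sweep _ _ s0 delta out (enc K w e).
by rewrite -e0 (transduce_mkseq es) /= eo size_mkseq addn2.
Qed.

Lemma realizes_cond d d' f g fa ga fb gb :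
  (forall w e, size e = d -> bounded w e -> size (g w e) = d' /\ bounded w (g w e)) ->
  realizes K d f g -> realizes K d' fa ga -> realizes K d' fb gb ->
  realizes K d (fun w e => if f w e then fa w (g w e) else fb w (g w e))
               (fun w e => if f w e then ga w (g w e) else gb w (g w e)).
Proof.
move=> G [M [T [pT H]]] [A [TA [pA HA]]] [B [TB [pB HB]]].
exists (cond M A B), (fun N => T N + (TA N + TB N)).
split; first by apply: polytimeD => //; apply: polytimeD.
move=> w e se be; have [sg bg] := G w e se be.
apply: spec_cond (H w e se be) _.
case: (f w e); [apply: spec_leq (HA _ _ sg bg)|apply: spec_leq (HB _ _ sg bg)].
  exact: leq_addr.
exact: leq_addl.
Qed.

Lemma realizes_seq d d' g fa ga :
  (forall w e, size e = d -> bounded w e -> size (g w e) = d' /\ bounded w (g w e)) ->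
  realizes K d (fun _ _ => true) g -> realizes K d' fa ga ->
  realizes K d (fun w e => fa w (g w e)) (fun w e => ga w (g w e)).
Proof. by move=> G Hg Ha; have := realizes_cond G Hg Ha Ha. Qed.

(** In the applications each round advances a mark, so at most [size w] rounds continue and one more
    stops; a polynomial bound for the body then gives one for the loop. *)
Lemma realizes_loop d d' f g (x : seq symbol -> seq nat -> nat -> seq nat)
    (n : seq symbol -> seq nat -> nat) :
  realizes K d' f g ->
  (forall w e, size e = d -> bounded w e ->
    [/\ n w e <= size w,
        forall i, i <= n w e -> size (x w e i) = d' /\ bounded w (x w e i),
        forall i, i < n w e -> f w (x w e i) /\ g w (x w e i) = x w e i.+1,
        f w (x w e (n w e)) = false & g w (x w e (n w e)) = x w e (n w e)]) ->
  realizes K d (fun _ _ => true) (fun w e => x w e 0) ->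
  realizes K d (fun _ _ => true) (fun w e => x w e (n w e)).
Proof.
move=> [M [T [pT HM]]] H [I [TI [pI HI]]].
exists (cond I (loop M) (loop M)), (fun N => TI N + (N + 1) * T N); split.
  apply: polytimeD => //; apply: polytimeM => //.
  by apply: polytimeD; [exact: polytime_id | exact: polytime_cst].
move=> w e se be; have [ln szb go f0 g0] := H w e se be.
apply: spec_cond (HI w e se be) _.
have L : (n w e).+1 * T (size w) <= (size w + 1) * T (size w).
  by rewrite leq_mul // addn1.
apply: spec_leq L _.
apply: (spec_loop (x := fun i => enc K w (x w e i))) => [i lti|].
  have [sx bx] := szb i (ltnW lti); have [fi gi] := go i lti.
  by have := HM w _ sx bx; rewrite fi gi.
by have [sx bx] := szb _ (leqnn _); have := HM w _ sx bx; rewrite f0 g0.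
Qed.

Definition mark (c : cell K) (v : nat) : bool :=
  if insub v is Some i then c.2 i else false.

Lemma mark_enc w e p v : v < K -> mark (enc_cell K w e p) v = (nth (size w) e v == p).
Proof. by move=> lt; rewrite /mark insubT ffunE. Qed.

Definition set_mark (c : cell K) (v : nat) (b : bool) : cell K :=
  (c.1, [ffun i : 'I_K => if i == v :> nat then b else c.2 i]).

Lemma realizes_cst d b : realizes K d (fun _ _ => b) (fun _ e => e).
Proof.
apply: (@realizes_sweep d unit tt (fun s c => (s, c)) (fun=> b) (fun _ _ _ => tt)).
by move=> w e _ _; split.
Qed.

Lemma realizes_lt d x y : d <= K -> x < d -> y < d ->
  realizes K d (fun _ e => nth 0 e x < nth 0 e y) (fun _ e => e).
Proof.
move=> dK xd yd.
(* The first mark met settles the comparison; [None] means that neither has been met. If there is no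
   mark at all, both values are [size w], and the answer is negative. *)
pose dl (s : option bool) c := (if s is Some _ then s else
  if mark c x then Some (~~ mark c y) else
  if mark c y then Some false else None, c : cell K).
pose st (w : seq symbol) e p := if minn (nth 0 e x) (nth 0 e y) < p
  then Some (nth 0 e x < nth 0 e y) else None.
apply: (@realizes_sweep d _ None dl (fun s => s == Some true) st).
move=> w e se be; rewrite /st; split=> [//||p lp].
  have := bounded_nth x be; have := bounded_nth y be.
  move: (nth 0 e x) (nth 0 e y) => a b hb ha.
  case: (ltnP a b) => h; case: ifP => //; lia.
rewrite /dl !mark_enc ?(leq_trans _ dK) //.
rewrite !(set_nth_default 0) ?se //.
move: (nth 0 e x) (nth 0 e y) => a b; congr pair.
case: (ltnP (minn a b) p) => h1; case: (ltnP (minn a b) p.+1) => h2; try lia; first by [].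
  case: (eqVneq a p) => ha; case: (eqVneq b p) => hb /=; try (exfalso; lia).
  - by congr Some; lia.
  - by congr Some; lia.
  - by congr Some; lia.
case: (eqVneq a p) => ha; case: (eqVneq b p) => hb /=; by [] || (exfalso; lia).
Qed.

(** The bound on the position belongs to the test because the default [None] is also the separator:
    a missing mark would pass for one. *)
Lemma realizes_sym d x a : d <= K -> x < d ->
  realizes K d (fun w e => (nth 0 e x < size w) && (nth None w (nth 0 e x) == a))
    (fun _ e => e).
Proof.
move=> dK xd.
pose dl (s : bool) (c : cell K) := (s || mark c x && (c.1 == a), c).
pose st (w : seq symbol) e p := (nth 0 e x < p) && (nth None w (nth 0 e x) == a).
apply: (@realizes_sweep d _ false dl id st).
move=> w e se be; rewrite /st; split=> // p lp.
rewrite /dl !mark_enc ?(leq_trans _ dK) // (set_nth_default 0) ?se //=.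
congr pair; rewrite ltnS [in RHS]leq_eqVlt.
by case: (eqVneq (nth 0 e x) p) => [<-|_]; rewrite ?ltnn ?orbF.
Qed.

Lemma realizes_present d x : d <= K -> x < d ->
  realizes K d (fun w e => nth 0 e x < size w) (fun _ e => e).
Proof.
move=> dK xd.
pose dl (s : bool) (c : cell K) := (s || mark c x, c).
pose st (w : seq symbol) e p := (nth 0 e x < p).
apply: (@realizes_sweep d _ false dl id st).
move=> w e se be; rewrite /st; split=> // p lp.
rewrite /dl !mark_enc ?(leq_trans _ dK) // (set_nth_default 0) ?se //=.
by congr pair; rewrite ltnS [in RHS]leq_eqVlt orbC.
Qed.

(** The sweep marks the first cell. The empty word has none, but there 0 equals [size w], which is
    represented by the absence of a mark. *)
Lemma realizes_push d : d < K ->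
  realizes K d (fun _ _ => true) (fun _ e => rcons e 0).
Proof.
move=> dK.
pose dl (s : bool) (c : cell K) := (false, set_mark c d s).
apply: (@realizes_sweep d _ true dl (fun=> true) (fun _ _ p => p == 0)).
move=> w e se be; split=> // p lp; rewrite /dl /set_mark /=; congr (_, (_, _)).
apply/ffunP=> v; rewrite !ffunE nth_rcons se.
case: ltngtP => h //.
by rewrite nth_default // se ltnW.
Qed.

Lemma realizes_pop d : d < K ->
  realizes K d.+1 (fun _ _ => true) (fun _ e => take d e).
Proof.
move=> dK.
pose dl (s : unit) (c : cell K) := (s, set_mark c d false).
apply: (@realizes_sweep d.+1 _ tt dl (fun=> true) (fun _ _ _ => tt)).
move=> w e se be; split=> // p lp; rewrite /dl /set_mark /=; congr (_, (_, _)).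
apply/ffunP=> v; rewrite !ffunE.
have st : size (take d e) = d by rewrite size_takel // se.
case: (ltngtP v d) => h; first by rewrite nth_take.
  by rewrite !nth_default ?st ?se // ltnW.
by rewrite nth_default ?st ?h //; rewrite gtn_eqF.
Qed.

(** The state remembers whether the previous cell held the mark. A mark on the last cell falls off,
    which is the value [size w]; hence the minimum. *)
Lemma realizes_shift d : d < K ->
  realizes K d.+1 (fun _ _ => true)
    (fun w e => rcons (take d e) (minn (nth 0 e d).+1 (size w))).
Proof.
move=> dK.
pose dl (s : bool) (c : cell K) := (mark c d, set_mark c d s).
apply: (@realizes_sweep d.+1 _ false dl (fun=> true)
  (fun _ e p => (0 < p) && (nth 0 e d == p.-1))).
move=> w e se be; split=> // p lp; rewrite /dl /set_mark /=.
rewrite mark_enc //= (set_nth_default 0) ?se //; congr (_, (_, _)).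
apply/ffunP=> v; rewrite !ffunE nth_rcons.
have st : size (take d e) = d by rewrite size_takel // se.
rewrite st; case: (ltngtP v d) => h; first by rewrite nth_take.
  by rewrite nth_default // se.
move: lp (bounded_nth d be); move: (nth 0 e d) (size w) => a N lp le.
case: (ltnP a.+1 N) => h1; case: p lp => [|p] lp /=; rewrite ?eqSS //; lia.
Qed.

(** Serves one round of bounded recursion: the new value on track [d.+2] replaces the accumulator on
    track [d], and the counter on track [d.+1] stays. *)
Lemma realizes_move d : d.+2 < K ->
  realizes K d.+3 (fun _ _ => true)
    (fun _ e => take d e ++ [:: nth 0 e d.+2; nth 0 e d.+1]).
Proof.
move=> dK.
pose dl (s : unit) (c : cell K) := (s, set_mark (set_mark c d (mark c d.+2)) d.+2 false).
apply: (@realizes_sweep d.+3 _ tt dl (fun=> true) (fun _ _ _ => tt)).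
move=> w e se be; split=> // p lp; rewrite /dl /set_mark /=; congr (_, (_, _)).
apply/ffunP=> v; rewrite !ffunE mark_enc // nth_cat.
have st : size (take d e) = d by rewrite size_takel // se; lia.
rewrite st; case: (ltngtP v d) => h; last first.
- rewrite h subnn /= ifN; last by lia.
  by rewrite (set_nth_default 0) ?se.
- case: (eqVneq (v : nat) d.+2) => [->|h2].
    by rewrite nth_default //=; [rewrite gtn_eqF | lia].
  case: (eqVneq (v : nat) d.+1) => [->|h1].
    by rewrite subSnn /= (set_nth_default 0) ?se.
  rewrite [nth _ e v]nth_default ?se; last by lia.
  by rewrite nth_default /=; last by lia.
- by rewrite ifN ?nth_take //; lia.
Qed.

End Realizes.

(** * Search and bounded recursion *)

Lemma find_iota_leq (a : pred nat) n : find a (iota 0 n) <= n.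
Proof. by rewrite -[leqRHS](size_iota 0) find_size. Qed.

Lemma before_find_iota (a : pred nat) n i : i < find a (iota 0 n) -> a i = false.
Proof.
move=> lt; have := before_find 0 lt.
by rewrite nth_iota // (leq_trans lt) // find_iota_leq.
Qed.

Lemma find_iotaP (a : pred nat) n : find a (iota 0 n) < n -> a (find a (iota 0 n)).
Proof.
move=> lt; have h : has a (iota 0 n) by rewrite has_find size_iota.
by have := nth_find 0 h; rewrite nth_iota.
Qed.

Lemma foldl_iotaS (T : Type) (f : T -> nat -> T) z n :
  foldl f z (iota 0 n.+1) = f (foldl f z (iota 0 n)) n.
Proof. by rewrite -addn1 iotaD foldl_cat. Qed.

Lemma rcons_take d (e : seq nat) : size e = d.+1 -> rcons (take d e) (nth 0 e d) = e.
Proof.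
by move=> se; rewrite -take_nth ?se // take_oversize ?se.
Qed.

Definition search (P : seq symbol -> seq nat -> bool) w e : nat :=
  find (fun k => P w (rcons e k)) (iota 0 (size w)).

(** Bounded recursion whose step is given by a graph [P]: the next value is the least one related to
    the accumulator [c] and the counter [k]. *)
Definition fold_search (P : seq symbol -> seq nat -> bool) w e (c : nat) (n : nat) : nat :=
  foldl (fun c k => search P w (e ++ [:: c; k])) c (iota 0 n).

Lemma search_leq P w e : search P w e <= size w.
Proof. exact: find_iota_leq. Qed.

Lemma fold_search_leq P w e c n : c <= size w -> fold_search P w e c n <= size w.
Proof.
case: n => [//|n] _; rewrite /fold_search foldl_iotaS; exact: search_leq.
Qed.

Section Realizes.
Variable K : nat.

Lemma realizes_search d P : d < K -> realizes K d.+1 P (fun _ e => e) ->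
  realizes K d (fun _ _ => true) (fun w e => rcons e (search P w e)).
Proof.
move=> dK HP.
have body : realizes K d.+1 (fun w e => (nth 0 e d < size w) && ~~ P w e)
   (fun w e => if (nth 0 e d < size w) && ~~ P w e then
      rcons (take d e) (minn (nth 0 e d).+1 (size w)) else e).
  have R1 := realizes_cond (fun w e s b => conj s b) HP
    (realizes_cst K d.+1 false) (realizes_shift dK).
  have R2 := realizes_cond (fun w e s b => conj s b)
    (realizes_present dK (ltnSn d)) R1 (realizes_cst K d.+1 false).
  by apply: realizes_ext R2 => w e _ _ /=; case: (_ < _); case: (P w e).
apply: (realizes_loop (x := fun _ e i => rcons e i) body); last exact: realizes_push.
move=> w e se be; set n := search P w e.
have ln : n <= size w by apply: search_leq.
have fE i : nth 0 (rcons e i) d = i by rewrite nth_rcons se ltnn eqxx.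
split=> // [i li|i li||].
- by rewrite size_rcons se bounded_rcons be (leq_trans li).
- have ltw := leq_trans li ln; rewrite fE ltw (before_find_iota li) /=; split=> //.
  by rewrite -(cats1 e i) take_size_cat // (minn_idPl ltw).
- rewrite fE; case: ltnP => //= lt; apply/negbTE; rewrite negbK.
  exact: (@find_iotaP (fun k => P w (rcons e k))).
- rewrite fE; case: ltnP => //= lt; rewrite ifN // negbK.
  exact: (@find_iotaP (fun k => P w (rcons e k))).
Qed.

Lemma realizes_fold d P : d.+2 < K -> realizes K d.+3 P (fun _ e => e) ->
  realizes K d.+1 (fun _ _ => true)
    (fun w e => rcons (take d e) (fold_search P w (take d e) (nth 0 e d) (size w))).
Proof.
move=> dK HP.
have S := realizes_search dK HP.
have body : realizes K d.+2 (fun w e => nth 0 e d.+1 < size w)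
   (fun w e => if nth 0 e d.+1 < size w then
      take d e ++ [:: search P w e; minn (nth 0 e d.+1).+1 (size w)] else e).
  have R1 : realizes K d.+3 (fun _ _ => true)
     (fun w e => take d e ++ [:: nth 0 e d.+2; minn (nth 0 e d.+1).+1 (size w)]).
    have G w e : size e = d.+3 -> bounded w e ->
        size (take d e ++ [:: nth 0 e d.+2; nth 0 e d.+1]) = d.+2 /\
        bounded w (take d e ++ [:: nth 0 e d.+2; nth 0 e d.+1]).
      move=> se be; rewrite size_cat size_takel ?se /=; last by lia.
      split; first by rewrite addn2.
      by rewrite bounded_cat bounded_take //= !bounded_nth.
    apply: realizes_ext (realizes_seq G (realizes_move dK) (realizes_shift (ltnW dK))).
    move=> w e se be /=; split=> //.
    have sr : size (rcons (take d e) (nth 0 e d.+2)) = d.+1.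
      by rewrite size_rcons size_takel // se; lia.
    have -> : take d e ++ [:: nth 0 e d.+2; nth 0 e d.+1] =
        rcons (take d e) (nth 0 e d.+2) ++ [:: nth 0 e d.+1].
      by rewrite cat_rcons.
    by rewrite take_size_cat // nth_cat sr ltnn subnn /= -!cats1 -catA.
  have G w e : size e = d.+2 -> bounded w e ->
      size (rcons e (search P w e)) = d.+3 /\ bounded w (rcons e (search P w e)).
    by move=> se be; rewrite size_rcons se bounded_rcons be search_leq.
  have R2 := realizes_cond (fun w e s b => conj s b)
    (realizes_present (ltnW dK) (ltnSn d.+1)) (realizes_seq G S R1)
    (realizes_cst K d.+2 false).
  apply: realizes_ext R2 => w e se be /=.
  case: ifP => // lt; split=> //; congr cat.
    by rewrite -cats1 takel_cat // se; lia.
  by rewrite !nth_rcons se ltnn eqxx ltnSn.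
(* Loop invariant: the accumulator after [i] rounds, then the counter. *)
pose x w e i := take d e ++ [:: fold_search P w (take d e) (nth 0 e d) i; i].
have sx w e i : size e = d.+1 -> size (x w e i) = d.+2.
  by move=> se; rewrite size_cat size_takel ?se ?addn2.
have x1 w e i : size e = d.+1 -> nth 0 (x w e i) d.+1 = i.
  by move=> se; rewrite nth_cat size_takel ?se // ltnNge leqnSn subSnn.
have L : realizes K d.+1 (fun _ _ => true) (fun w e => x w e (size w)).
  apply: (realizes_loop (n := fun w _ => size w) body) => [w e se be|].
    split=> // [i li|i li||].
    - split; first exact: sx.
      by rewrite bounded_cat bounded_take //= li fold_search_leq ?bounded_nth.
    - rewrite x1 // li; split=> //; rewrite (minn_idPl li) /x.
      rewrite take_size_cat ?size_takel ?se //.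
      by rewrite /fold_search foldl_iotaS.
    - by rewrite x1 // ltnn.
    - by rewrite x1 // ltnn.
  apply: realizes_ext (realizes_push (ltnW dK)) => w e se be; split=> //.
  by rewrite /x /fold_search /= -{1}(rcons_take se) -!cats1 -catA.
have G w e : size e = d.+1 -> bounded w e ->
    size (x w e (size w)) = d.+2 /\ bounded w (x w e (size w)).
  move=> se be; split; first exact: sx.
  by rewrite bounded_cat bounded_take //= leqnn fold_search_leq ?bounded_nth.
apply: realizes_ext (realizes_seq G L (realizes_pop (ltnW dK))) => w e se be.
split=> //; rewrite /x -cat_rcons take_size_cat //.
by rewrite size_rcons size_takel ?se.
Qed.

End Realizes.

(** * Decidable predicates *)

Definition pick (s e : seq nat) : seq nat := [seq nth 0 e i | i <- s].

Lemma pick_iota d e : d <= size e -> pick (iota 0 d) e = take d e.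
Proof. by move=> le; rewrite /pick map_nth_iota0. Qed.

Lemma bounded_pick w s e : bounded w e -> bounded w (pick s e).
Proof. by move=> be; apply/allP => _ /mapP[i _ ->]; apply: bounded_nth. Qed.

Lemma pick_catl s e e' : all (fun i => i < size e) s -> pick s (e ++ e') = pick s e.
Proof. by move/allP => h; apply/eq_in_map => i /h lt; rewrite nth_cat lt. Qed.

Lemma pick_pick s s' e : all (fun i => i < size s') s ->
  pick s (pick s' e) = pick (pick s s') e.
Proof.
move/allP => h; rewrite /pick -map_comp; apply/eq_in_map => i /h lt /=.
by rewrite (nth_map 0).
Qed.

(** Every sufficiently large number of tracks must do, so that predicates built separately can be
    brought onto a common alphabet. *)
Definition dec d (P : seq symbol -> seq nat -> bool) : Prop :=
  exists K0, forall K, K0 <= K -> realizes K d P (fun _ e => e).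

(* Closed under renaming of the variables, so that quantifiers may allocate
   their tracks behind all the tracks in use. *)
Definition decp d (P : seq symbol -> seq nat -> bool) : Prop :=
  forall d' s, size s = d -> all (fun i => i < d') s ->
  dec d' (fun w e => P w (pick s e)).

Lemma dec_ext d P Q :
  (forall w e, size e = d -> bounded w e -> P w e = Q w e) -> dec d P -> dec d Q.
Proof.
move=> E [K0 H]; exists K0 => K /H; apply: realizes_ext => w e se be.
by rewrite E.
Qed.

Lemma decp_ext d P Q :
  (forall w e, size e = d -> bounded w e -> P w e = Q w e) -> decp d P -> decp d Q.
Proof.
move=> E H d' s ss ls; apply: dec_ext (H d' s ss ls) => w e se be.
by apply: E; [rewrite size_map | exact: bounded_pick].
Qed.

Lemma decp_ren d d' s P : size s = d -> all (fun i => i < d') s -> decp d P ->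
  decp d' (fun w e => P w (pick s e)).
Proof.
move=> ss ls H d'' s' ss' ls'.
have := H d'' (pick s s'); rewrite size_map ss => /(_ erefl) H'.
apply: dec_ext (H' _) => [w e _ _|]; first by rewrite pick_pick ?ss'.
apply/allP => _ /mapP[i /(allP ls) lt ->].
by apply: (allP ls'); rewrite mem_nth ?ss'.
Qed.

Lemma decp_cst d b : decp d (fun _ _ => b).
Proof. by move=> d' s _ _; exists 0 => K _; apply: realizes_cst. Qed.

Lemma decp_lt d x y : x < d -> y < d -> decp d (fun _ e => nth 0 e x < nth 0 e y).
Proof.
move=> xd yd d' s ss ls; exists d' => K le.
have lt i : i < d -> nth 0 s i < d' by move=> h; apply: (allP ls); rewrite mem_nth ?ss.
apply: realizes_ext (realizes_lt le (lt _ xd) (lt _ yd)) => w e se be.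
by rewrite /pick !(nth_map 0) ?ss.
Qed.

Lemma decp_sym d x a : x < d ->
  decp d (fun w e => (nth 0 e x < size w) && (nth None w (nth 0 e x) == a)).
Proof.
move=> xd d' s ss ls; exists d' => K le.
have lt i : i < d -> nth 0 s i < d' by move=> h; apply: (allP ls); rewrite mem_nth ?ss.
apply: realizes_ext (realizes_sym a le (lt _ xd)) => w e se be.
by rewrite /pick !(nth_map 0) ?ss.
Qed.

Lemma decp_if d P Q R : decp d P -> decp d Q -> decp d R ->
  decp d (fun w e => if P w e then Q w e else R w e).
Proof.
move=> HP HQ HR d' s ss ls.
have [K1 H1] := HP d' s ss ls; have [K2 H2] := HQ d' s ss ls.
have [K3 H3] := HR d' s ss ls; exists (maxn K1 (maxn K2 K3)) => K.
rewrite !geq_max => /and3P[/H1 R1 /H2 R2 /H3 R3].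
have := realizes_cond (fun w e s b => conj s b) R1 R2 R3.
by apply: realizes_ext => w e se be; split=> //; case: ifP.
Qed.

Lemma decp_not d P : decp d P -> decp d (fun w e => ~~ P w e).
Proof.
move=> H; apply: decp_ext (decp_if H (@decp_cst d false) (@decp_cst d true)).
by move=> w e _ _; case: (P w e).
Qed.

Lemma decp_and d P Q : decp d P -> decp d Q -> decp d (fun w e => P w e && Q w e).
Proof. by move=> HP HQ; apply: decp_if => //; apply: decp_cst. Qed.

Lemma decp_or d P Q : decp d P -> decp d Q -> decp d (fun w e => P w e || Q w e).
Proof. by move=> HP HQ; apply: decp_if => //; apply: decp_cst. Qed.

Lemma decp_eqb d P Q : decp d P -> decp d Q -> decp d (fun w e => P w e == Q w e).
Proof.
move=> HP HQ; apply: decp_ext (decp_if HP HQ (decp_not HQ)).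
by move=> w e _ _; case: (P w e) (Q w e) => -[].
Qed.

(** The answer must survive the erasure of the track; it is kept in the control by branching on it
    and erasing in both branches. *)
Lemma realizes_pop_test K d P : d < K -> realizes K d.+1 P (fun _ e => e) ->
  realizes K d.+1 P (fun _ e => take d e).
Proof.
move=> dK H.
have G w e : size e = d.+1 -> bounded w e -> size (take d e) = d /\ bounded w (take d e).
  by move=> se be; rewrite size_takel ?se // bounded_take.
have R b : realizes K d.+1 (fun _ _ => b) (fun _ e => take d e).
  exact: realizes_seq G (realizes_pop dK) (realizes_cst K d b).
have := realizes_cond (fun w e s b => conj s b) H (R true) (R false).
by apply: realizes_ext => w e _ _ /=; case: (P w e).
Qed.

(** The default result [size w] is the one candidate that the search itself does not test, so
    testing [P] at the result decides existence up to and including [size w]. *)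
Lemma has_search P w e :
  P w (rcons e (search P w e)) = has (fun k => P w (rcons e k)) (iota 0 (size w).+1).
Proof.
apply/idP/hasP => [h|[k]].
  by exists (search P w e) => //; rewrite mem_iota ltnS search_leq.
rewrite mem_iota ltnS /= => le h.
have := search_leq P w e; rewrite leq_eqVlt => /orP[/eqP E|lt]; last first.
  exact: (@find_iotaP (fun k => P w (rcons e k))).
case: (ltnP k (search P w e)) => [lt|]; last first.
  by rewrite E => le'; rewrite (@anti_leq (size w) k) // le le'.
by have := before_find_iota lt; rewrite h.
Qed.

Lemma decp_ex d P : decp d.+1 P ->
  decp d (fun w e => has (fun k => P w (rcons e k)) (iota 0 (size w).+1)).
Proof.
move=> H d' s ss ls.
(* The bound variable receives the fresh track [d'], whatever tracks [s] the free variables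
   occupy. *)
have [||K0 HK] := H d'.+1 (rcons s d').
- by rewrite size_rcons ss.
- by rewrite all_rcons ltnSn; apply: sub_all ls => i /ltnW.
exists (maxn K0 d'.+1) => K; rewrite geq_max => /andP[/HK R dK].
have G w e : size e = d' -> bounded w e ->
    size (rcons e (search (fun w e => P w (pick (rcons s d') e)) w e)) = d'.+1 /\
    bounded w (rcons e (search (fun w e => P w (pick (rcons s d') e)) w e)).
  by move=> se be; rewrite size_rcons se bounded_rcons be search_leq.
have := realizes_seq G (realizes_search dK R) (realizes_pop_test dK R).
apply: realizes_ext => w e se be; split; last by rewrite -cats1 take_size_cat.
rewrite [LHS](has_search (fun w e => P w (pick (rcons s d') e))).
apply: eq_has => k; congr (P w _).
rewrite /pick map_rcons nth_rcons se ltnn eqxx; congr rcons.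
by rewrite -cats1 -/(pick _ _) pick_catl ?se.
Qed.

(** [P0] supplies the initial accumulator, [P] the step, and [Q] judges the final value. The fresh
    tracks [d'], [d'.+1] and [d'.+2] hold the accumulator, the counter and the candidate for the
    next value. *)
Lemma decp_fold_search d P0 P Q : decp d.+1 P0 -> decp d.+3 P -> decp d.+1 Q ->
  decp d (fun w e => Q w (rcons e (fold_search P w e (search P0 w e) (size w)))).
Proof.
move=> H0 H HQ d' s ss ls.
have ls1 : all (fun i => i < d'.+1) (rcons s d').
  by rewrite all_rcons ltnSn; apply: sub_all ls => i /ltnW.
have [|K0 HK0] := H0 d'.+1 (rcons s d') _ ls1; first by rewrite size_rcons ss.
have [|K1 HK1] := HQ d'.+1 (rcons s d') _ ls1; first by rewrite size_rcons ss.
have [||K2 HK2] := H d'.+3 (s ++ [:: d'; d'.+1; d'.+2]).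
- by rewrite size_cat ss addn3.
- rewrite all_cat /=; apply/andP; split; last by lia.
  by apply: sub_all ls => i; lia.
exists (maxn (maxn K0 K1) (maxn K2 d'.+3)) => K.
rewrite !geq_max => /andP[/andP[/HK0 R0 /HK1 R1] /andP[/HK2 R2 dK]].
pose P0' w e := P0 w (pick (rcons s d') e).
pose P' w e := P w (pick (s ++ [:: d'; d'.+1; d'.+2]) e).
have dK1 : d' < K by lia.
have G w e : size e = d' -> bounded w e ->
    size (rcons e (search P0' w e)) = d'.+1 /\ bounded w (rcons e (search P0' w e)).
  by move=> se be; rewrite size_rcons se bounded_rcons be search_leq.
have S1 := realizes_seq G (realizes_search dK1 R0) (realizes_fold dK R2).
have G' w e : size e = d' -> bounded w e ->
    let r := rcons e (search P0' w e) in
    let r' := rcons (take d' r) (fold_search P' w (take d' r) (nth 0 r d') (size w)) in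
    size r' = d'.+1 /\ bounded w r'.
  move=> se be r r'; have [sr br] := G w e se be.
  rewrite size_rcons size_takel ?sr // bounded_rcons bounded_take //.
  by rewrite fold_search_leq // bounded_nth.
apply: realizes_ext (realizes_seq G' S1 (realizes_pop_test dK1 R1)) => w e se be.
have tE k : take d' (rcons e k) = e by rewrite -cats1 take_size_cat.
have nE k : nth 0 (rcons e k) d' = k by rewrite nth_rcons se ltnn eqxx.
have pE k : pick (rcons s d') (rcons e k) = rcons (pick s e) k.
  rewrite /pick map_rcons nE; congr rcons.
  by rewrite -cats1 -/(pick _ _) pick_catl ?se.
rewrite tE nE tE pE; split=> //; congr (Q w (rcons _ _)).
have -> : search P0' w e = search P0 w (pick s e).
  by apply: eq_find => k; rewrite /P0' pE.
rewrite /fold_search; elim: (iota _ _) (search _ _ _) => //= k l IH c.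
rewrite IH; congr foldl; apply: eq_find => c'; rewrite /P'; congr (P w _).
rewrite /pick map_cat /= !rcons_cat !nth_cat se ltnn subnn subSnn.
rewrite ifN -?leqNgt ?leqnSn // ifN -?leqNgt; last by lia.
have -> : d'.+2 - d' = 2 by lia.
by congr cat; rewrite -/(pick _ _) pick_catl ?se.
Qed.

(** * Closed predicates as Turing machines *)

Section Machine.
Variables (K : nat) (M : fragment (cell K)).

Definition input_cell (a : symbol) : option (cell K) := Some (a, [ffun=> false]).

Lemma input_cell_inj : injective input_cell.
Proof. by move=> a b []. Qed.

Definition machine_delta (q : fstate M + bool)
    (r : {ffun unit -> option (cell K)}) :
    (fstate M + bool) * {ffun unit -> option (cell K) * move} :=
  match q with
  | inl q => let: (q', act) := fstep q (r tt) in (q', [ffun=> act])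
  | inr b => (inr b, [ffun=> (None, Stay)])
  end.

Definition machine : TM symbol :=
  @Build_TM symbol (fstate M + bool)%type (option (cell K)) unit tt None input_cell
    input_cell_inj (fun a => isT) (inl (fstart M)) (inr true) (inr false)
    isT machine_delta.

Lemma machine_steps q t b t' k : @fruns _ M q t b t' k ->
  cstate (iter k (@tm_step _ machine) (@Config _ machine (inl q) [ffun=> t])) = inr b.
Proof.
have E q0 t0 : @tm_step _ machine (@Config _ machine (inl q0) [ffun=> t0]) =
    @Config _ machine (fstep q0 (Defs.thead t0)).1
      [ffun=> tape_move None (fstep q0 (Defs.thead t0)).2.2
              (tape_write (fstep q0 (Defs.thead t0)).2.1 t0)].
  rewrite /tm_step /= !ffunE; case: (fstep _ _) => q' act /=; congr Config.
  by apply/ffunP => i; rewrite !ffunE.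
elim=> {q t b t' k} [q t b a d st|q t q' a d b t' k st _ IH].
  by rewrite /= E st.
by rewrite iterSr E st /=.
Qed.

End Machine.

(** Without variables all tracks are empty, so the initial tape already carries the encoded word;
    the number [K] of tracks is fixed before [w], so the alphabet is finite. *)
Lemma decp_in_P (P : seq symbol -> seq nat -> bool) (L : language symbol) :
  decp 0 P -> (forall w, P w [::] <-> L w) -> in_P L.
Proof.
move=> H PL; have [K HK] := H 0 [::] erefl erefl.
have [M [T [[p leT] HM]]] := HK K (leqnn K).
exists (machine M), p => w.
have [|t' [k [_ lek run]]] := HM w [::] erefl erefl
  (Tape [::] (head None (map (@input_cell K) w)) (behead (map (@input_cell K) w))).
  exists 0, 0; rewrite /= cats0 /enc /tape_at.
  suff -> : map (@input_cell K) w = map Some (mkseq (enc_cell K w [::]) (size w)) by [].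
  rewrite -[w in LHS](mkseq_nth None) -!map_comp; apply/eq_in_map => i.
  rewrite mem_iota /= => lt; rewrite /input_cell; congr (Some (_, _)).
  by apply/ffunP => v; rewrite !ffunE nth_nil gtn_eqF.
exists k; have := machine_steps run.
have -> : @Config _ (machine M) (inl (fstart M)) [ffun=> Tape [::]
    (head None (map (@input_cell K) w)) (behead (map (@input_cell K) w))] =
  tm_init (machine M) w.
  by rewrite /tm_init; congr Config; apply/ffunP => -[]; rewrite !ffunE.
rewrite -/(tm_run _ _ _) => E; split; first exact: leq_trans lek (leT _).
  by rewrite /halted E; case: (P w _).
by rewrite E -PL /=; case: (P w [::]); split.
Qed.

(** * Quantifiers, Boolean combinations, and functions given by their graphs *)

Lemma size_rcons_eq d (e : seq nat) k : size e = d -> size (rcons e k) = d.+1.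
Proof. by rewrite size_rcons => ->. Qed.

Lemma take_rcons_eq d (e : seq nat) k : size e = d -> take d (rcons e k) = e.
Proof. by move=> <-; rewrite -cats1 take_size_cat. Qed.

Lemma nth_rcons_eq d (e : seq nat) k : size e = d -> nth 0 (rcons e k) d = k.
Proof. by move=> <-; rewrite nth_rcons ltnn eqxx. Qed.

Lemma decp_leq d x y : x < d -> y < d -> decp d (fun _ e => nth 0 e x <= nth 0 e y).
Proof.
move=> xd yd; apply: decp_ext (decp_not (decp_lt yd xd)) => w e _ _.
by rewrite -leqNgt.
Qed.

Lemma decp_eq d x y : x < d -> y < d -> decp d (fun _ e => nth 0 e x == nth 0 e y).
Proof.
move=> xd yd; apply: decp_ext (decp_and (decp_leq xd yd) (decp_leq yd xd)) => w e _ _.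
by rewrite eqn_leq.
Qed.

Lemma decp_exists d P (Q : seq symbol -> seq nat -> bool) : decp d.+1 P ->
  (forall w e, size e = d -> bounded w e ->
     Q w e <-> exists k, k <= size w /\ P w (rcons e k)) ->
  decp d Q.
Proof.
move=> HP PQ; apply: decp_ext (decp_ex HP) => w e se be.
apply/hasP/idP => [[k]|/(PQ w e se be)[k [le p]]].
  by rewrite mem_iota ltnS => le p; apply/PQ => //; exists k.
by exists k; rewrite // mem_iota ltnS.
Qed.

Lemma decp_all (I : Type) d (P : I -> seq symbol -> seq nat -> bool) (r : seq I) :
  (forall i, decp d (P i)) -> decp d (fun w e => all (fun i => P i w e) r).
Proof.
move=> H; elim: r => [|i r IH] /=; first exact: (@decp_cst d true).
exact: decp_and.
Qed.

Lemma decp_forall (I : finType) d (P : I -> seq symbol -> seq nat -> bool) :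
  (forall i, decp d (P i)) -> decp d (fun w e => [forall i, P i w e]).
Proof.
move=> H; apply: decp_ext (decp_all (enum I) H) => w e _ _.
apply/allP/forallP => h i; last by move=> _; apply: h.
by apply: h; rewrite mem_enum.
Qed.

(** Disjunction over the finitely many truth assignments [b] on which [f] holds, written as a
    negated conjunction. *)
Lemma decp_bool (I : finType) (f : {ffun I -> bool} -> bool) d
    (P : I -> seq symbol -> seq nat -> bool) :
  (forall i, decp d (P i)) -> decp d (fun w e => f [ffun i => P i w e]).
Proof.
move=> H.
have Hb (b : {ffun I -> bool}) :
    decp d (fun w e => ~~ (f b && [forall i, P i w e == b i])).
  apply: decp_not; apply: decp_and; first exact: decp_cst.
  by apply: decp_forall => i; apply: decp_eqb => //; apply: decp_cst.
apply: decp_ext (decp_not (decp_forall Hb)) => w e _ _.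
rewrite negb_forall; apply/existsP/idP => [[b]|h].
  rewrite negbK => /andP[fb /forallP E].
  by congr (f _): fb; apply/ffunP => i; rewrite ffunE (eqP (E i)).
exists [ffun i => P i w e]; rewrite negbK h /=.
by apply/forallP => i; rewrite ffunE.
Qed.

(** Fragments answer predicates, so a function enters through its graph, with the value as last
    variable; the bound makes the value representable by a mark. *)
Definition fn d (t : seq symbol -> seq nat -> nat) : Prop :=
  (forall w e, size e = d -> bounded w e -> t w e <= size w) /\
  decp d.+1 (fun w e => t w (take d e) == nth 0 e d).

Lemma decp_push d t P : fn d t -> decp d.+1 P ->
  decp d (fun w e => P w (rcons e (t w e))).
Proof.
move=> [bt gt] HP; apply: decp_exists (decp_and gt HP) _ => w e se be.
split=> [p|[k []]]; last by rewrite take_rcons_eq // nth_rcons_eq // => _ /andP[/eqP ->].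
by exists (t w e); rewrite bt // take_rcons_eq // nth_rcons_eq // eqxx.
Qed.

Lemma find_eq_iota v n : v <= n -> find (fun k => v == k) (iota 0 n) = v.
Proof.
move=> le; have := find_iota_leq (fun k => v == k) n.
rewrite leq_eqVlt => /orP[/eqP E|/find_iotaP /eqP <- //].
apply/eqP; rewrite eqn_leq E le andbT leqNgt; apply/negP => lt.
by have := @before_find_iota (fun k => v == k) n v; rewrite E eqxx => /(_ lt).
Qed.

Lemma fn_fold d t0 s : fn d t0 -> fn d.+2 s ->
  fn d (fun w e => foldl (fun c k => s w (e ++ [:: c; k])) (t0 w e) (iota 0 (size w))).
Proof.
move=> [b0 g0] [bs gs]; split=> [w e se be|].
  have : forall n, n <= size w ->
    foldl (fun c k => s w (e ++ [:: c; k])) (t0 w e) (iota 0 n) <= size w.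
    elim=> [|n IH] le; first exact: b0.
    rewrite foldl_iotaS; apply: bs; first by rewrite size_cat se addn2.
    by rewrite bounded_cat be /= IH ltnW.
  exact.
(* Variable [d] holds the proposed value of the fold, so the accumulator, the counter and the next
   value sit at [d.+1], [d.+2] and [d.+3]. *)
have R0 : decp d.+2 (fun w e => t0 w (take d e) == nth 0 e d.+1).
  apply: decp_ext (decp_ren (s := rcons (iota 0 d) d.+1) _ _ g0).
  - move=> w e se be; rewrite /pick map_rcons -/(pick _ _) pick_iota ?se //; last by lia.
    have st : size (take d e) = d by rewrite size_takel // se; lia.
    by rewrite take_rcons_eq ?nth_rcons_eq.
  - by rewrite size_rcons size_iota.
  - by rewrite all_rcons ltnSn; apply/allP => i; rewrite mem_iota; lia.
have R1 : decp d.+4 (fun w e =>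
    s w (take d e ++ [:: nth 0 e d.+1; nth 0 e d.+2]) == nth 0 e d.+3).
  apply: decp_ext (decp_ren (s := iota 0 d ++ [:: d.+1; d.+2; d.+3]) _ _ gs).
  - move=> w e se be; rewrite /pick map_cat -/(pick _ _) pick_iota ?se; last by lia.
    have st : size (take d e) = d by rewrite size_takel // se; lia.
    have -> : take d e ++ [seq nth 0 e i | i <- [:: d.+1; d.+2; d.+3]] =
      rcons (take d e ++ [:: nth 0 e d.+1; nth 0 e d.+2]) (nth 0 e d.+3).
      by rewrite rcons_cat.
    by rewrite take_rcons_eq ?nth_rcons_eq // size_cat st addn2.
  - by rewrite size_cat size_iota addn3.
  - rewrite all_cat /=; apply/andP; split; last by lia.
    by apply/allP => i; rewrite mem_iota; lia.
have R2 : decp d.+2 (fun w e => nth 0 e d.+1 == nth 0 e d) by apply: decp_eq.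
apply: decp_ext (decp_fold_search R0 R1 R2) => w e se be.
rewrite nth_rcons_eq // nth_rcons se ltnSn; congr (_ == _).
have st : size (take d e) = d by rewrite size_takel // se.
have -> : search (fun w e => t0 w (take d e) == nth 0 e d.+1) w e = t0 w (take d e).
  rewrite /search -[RHS](@find_eq_iota _ (size w)); last first.
    by apply: b0 => //; apply: bounded_take.
  by apply: eq_find => k; rewrite nth_rcons_eq // -cats1 takel_cat // se.
have : forall n, n <= size w ->
  fold_search (fun w e => s w (take d e ++ [:: nth 0 e d.+1; nth 0 e d.+2]) == nth 0 e d.+3)
     w e (t0 w (take d e)) n =
  foldl (fun c k => s w (take d e ++ [:: c; k])) (t0 w (take d e)) (iota 0 n).
  elim=> [|n IH] le //; rewrite foldl_iotaS -IH; last exact: ltnW.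
  rewrite /fold_search foldl_iotaS.
  set c := foldl _ _ _.
  have lc : c <= size w.
    by apply: fold_search_leq; apply: b0 => //; apply: bounded_take.
  rewrite /search -[RHS](@find_eq_iota _ (size w)); last first.
    apply: bs; first by rewrite size_cat st addn2.
    by rewrite bounded_cat bounded_take //= lc ltnW.
  apply: eq_find => k; rewrite -cats1 -catA /= takel_cat ?se //.
  have nE i : nth 0 (e ++ [:: c; n; k]) (d.+1 + i) = nth 0 [:: c; n; k] i.
    by rewrite nth_cat se ltnNge leq_addr addKn.
  by move: (nE 0) (nE 1) (nE 2); rewrite addn0 addn1 addn2 => -> -> ->.
exact.
Qed.

(** Order is the only primitive relation between variables; zero, successor and the end of the word
    are defined from it by bounded quantifiers. *)
Lemma decp_zero d x : x < d -> decp d (fun _ e => nth 0 e x == 0).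
Proof.
move=> xd; have H : decp d.+1 (fun _ e => nth 0 e d < nth 0 e x).
  by apply: decp_lt; rewrite // ltnW.
apply: decp_ext (decp_not (decp_ex H)) => w e se be.
apply/hasPn/eqP => [h|E k _]; last by rewrite (nth_rcons_eq _ se) nth_rcons se xd E.
apply/eqP; rewrite -leqn0 leqNgt; apply/negP => lt.
by have := h 0; rewrite (nth_rcons_eq _ se) nth_rcons se xd lt => /(_ isT).
Qed.

Lemma decp_succ d x y : x < d -> y < d ->
  decp d (fun _ e => nth 0 e y == (nth 0 e x).+1).
Proof.
move=> xd yd.
have H : decp d.+1 (fun _ e => (nth 0 e x < nth 0 e d) && (nth 0 e d < nth 0 e y)).
  by apply: decp_and; apply: decp_lt; rewrite // ltnW.
apply: decp_ext (decp_and (decp_lt xd yd) (decp_not (decp_ex H))) => w e se be.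
apply/andP/eqP => [[lt /hasPn h]|E].
  apply/eqP; rewrite eqn_leq lt andbT leqNgt; apply/negP => lt2.
  have := h (nth 0 e x).+1; rewrite (nth_rcons_eq _ se) !nth_rcons se xd yd lt2 ltnSn.
  move=> /(_ _)/negP []//; rewrite mem_iota /= ltnS.
  by apply: leq_trans (ltnW lt2) (bounded_nth _ be).
split; first by rewrite E.
by apply/hasPn => k _; rewrite (nth_rcons_eq _ se) !nth_rcons se xd yd E; lia.
Qed.

Lemma decp_inside d x : x < d -> decp d (fun w e => nth 0 e x < size w).
Proof.
move=> xd; apply: (decp_exists (P := fun _ e => nth 0 e x < nth 0 e d)).
  by apply: decp_lt; rewrite // ltnW.
move=> w e se be; split=> [lt|[k []]].
  by exists (size w); rewrite (nth_rcons_eq _ se) nth_rcons se xd.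
by rewrite (nth_rcons_eq _ se) nth_rcons se xd => le lt; apply: leq_trans lt le.
Qed.

Lemma fn_count d P : decp d.+1 P ->
  fn d (fun w e => count (fun k => P w (rcons e k)) (iota 0 (size w))).
Proof.
move=> HP.
(* The guard keeps the step within [size w] on every environment, as [fn] demands; during the actual
   recursion the count stays below [size w] and the guard holds. *)
pose s w e := if P w (rcons (take d e) (nth 0 e d.+1)) && (nth 0 e d < size w)
  then (nth 0 e d).+1 else nth 0 e d.
have Hs : fn d.+2 s.
  split=> [w e se be|].
    by rewrite /s; case: ifP => [/andP[]//|_]; apply: bounded_nth.
  have R : decp d.+3 (fun w e => P w (rcons (take d e) (nth 0 e d.+1))).
    apply: decp_ext (decp_ren (s := rcons (iota 0 d) d.+1) _ _ HP).
    - move=> w e se be; rewrite /pick map_rcons -/(pick _ _) pick_iota ?se //.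
      by lia.
    - by rewrite size_rcons size_iota.
    - by rewrite all_rcons; apply/andP; split; [|apply/allP => i; rewrite mem_iota]; lia.
  have I : decp d.+3 (fun w e => nth 0 e d < size w) by apply: decp_inside; lia.
  have S : decp d.+3 (fun w e => nth 0 e d.+2 == (nth 0 e d).+1).
    by apply: decp_succ; lia.
  have Q : decp d.+3 (fun w e => nth 0 e d.+2 == nth 0 e d) by apply: decp_eq; lia.
  apply: decp_ext (decp_if (decp_and R I) S Q) => w e se be; rewrite /s.
  have -> : take d (take d.+2 e) = take d e by rewrite take_takel //; lia.
  rewrite !nth_take //.
  by case: ifP => _; rewrite eq_sym.
have H0 : fn d (fun _ _ => 0).
  split=> //; apply: decp_ext (decp_zero (ltnSn d)) => w e _ _.
  by rewrite eq_sym.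
have [bf gf] := fn_fold H0 Hs.
have E w e : size e = d ->
    foldl (fun c k => s w (e ++ [:: c; k])) 0 (iota 0 (size w)) =
    count (fun k => P w (rcons e k)) (iota 0 (size w)).
  move=> se; have : forall n, n <= size w ->
    foldl (fun c k => s w (e ++ [:: c; k])) 0 (iota 0 n) =
    count (fun k => P w (rcons e k)) (iota 0 n).
    elim=> [|n IH] le //; rewrite foldl_iotaS IH; last exact: ltnW.
    rewrite -[in RHS]addn1 iotaD count_cat /= addn0 add0n.
    set c := count _ (iota 0 n).
    have lc : c < size w.
      by apply: leq_trans le; rewrite ltnS /c -[leqRHS](size_iota 0) count_size.
    rewrite /s take_size_cat // !nth_cat se ltnn subnn subSnn ltnNge leqnSn /= lc andbT.
    by case: (P w _); rewrite ?addn1 ?addn0.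
  exact.
split=> [w e se be|]; first by rewrite -E // bf.
apply: decp_ext gf => w e se be; rewrite E //.
by rewrite size_takel // se.
Qed.

(** * Arithmetic and numerals *)

Lemma mem_iota0 n i : (i \in iota 0 n) = (i < n).
Proof. by rewrite mem_iota. Qed.

Lemma count_iota_between a b n : b <= n ->
  count (fun k => (a <= k) && (k < b)) (iota 0 n) = b - a.
Proof.
have E : forall n, count (fun k => (a <= k) && (k < b)) (iota 0 n) = minn b n - a.
  elim=> [|k IH]; first by rewrite minn0.
  rewrite -[in iota _ _]addn1 iotaD count_cat IH /= addn0 add0n.
  by case: (leqP a k) => h1; case: (ltnP k b) => h2 /=; lia.
by move=> le; rewrite E (minn_idPl le).
Qed.

(** Addition through counting: for x <= z, the sum x + y is z exactly when y positions k satisfy x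
    <= k < z. *)
Lemma decp_add d x y z : x < d -> y < d -> z < d ->
  decp d (fun _ e => nth 0 e x + nth 0 e y == nth 0 e z).
Proof.
move=> xd yd zd.
have H : decp d.+1 (fun _ e => (nth 0 e x <= nth 0 e d) && (nth 0 e d < nth 0 e z)).
  by apply: decp_and; [apply: decp_leq | apply: decp_lt]; rewrite // ltnW.
have Q : decp d.+1 (fun _ e => nth 0 e d == nth 0 e y) by apply: decp_eq; rewrite // ltnW.
apply: decp_ext (decp_and (decp_leq xd zd) (decp_push (fn_count H) Q)) => w e se be.
rewrite (nth_rcons_eq _ se) nth_rcons se yd.
under eq_count => k do rewrite (nth_rcons_eq _ se) !nth_rcons se xd zd.
by rewrite count_iota_between ?bounded_nth //; apply/idP/idP; lia.
Qed.

Lemma decp_odd d x : x < d -> decp d (fun _ e => odd (nth 0 e x)).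
Proof.
move=> xd; have H : decp d.+1 (fun _ e => nth 0 e d + nth 0 e d == nth 0 e x).
  by apply: decp_add; rewrite // ltnW.
apply: decp_ext (decp_not (decp_ex H)) => w e se be.
apply/hasPn/idP => [h|o k _]; last first.
  by rewrite (nth_rcons_eq _ se) nth_rcons se xd; apply/eqP; lia.
apply/negPn/negP => o.
have := h (nth 0 e x)./2; rewrite (nth_rcons_eq _ se) nth_rcons se xd addnn even_halfK ?eqxx //.
move=> /(_ _)/negP []//; rewrite mem_iota0 ltnS.
by have := bounded_nth x be; lia.
Qed.

Lemma decp_half d x y : x < d -> y < d ->
  decp d (fun _ e => (nth 0 e x)./2 == nth 0 e y).
Proof.
move=> xd yd.
have H1 : decp d (fun _ e => nth 0 e y + nth 0 e y == nth 0 e x) by apply: decp_add.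
have H2 : decp d.+1 (fun _ e => (nth 0 e y + nth 0 e y == nth 0 e d) &&
    (nth 0 e x == (nth 0 e d).+1)).
  by apply: decp_and; [apply: decp_add | apply: decp_succ]; rewrite // ltnW.
apply: decp_ext (decp_or H1 (decp_ex H2)) => w e se be.
apply/orP/eqP => [[/eqP|/hasP[k _]]|E]; first by lia.
  by rewrite (nth_rcons_eq _ se) !nth_rcons se xd yd; lia.
case: (boolP (odd (nth 0 e x))) => o; last by left; apply/eqP; lia.
right; apply/hasP; exists (nth 0 e x).-1.
  by rewrite mem_iota0 ltnS; have := bounded_nth x be; lia.
by rewrite (nth_rcons_eq _ se) !nth_rcons se xd yd; lia.
Qed.

Definition digit_step (N c : nat) (b : option bool) : nat :=
  if [|| c == N, c == 0 | b != Some (odd c)] then N else c./2.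

(* Division by two strips the digits of [c] off, the value [N] standing for
   failure. *)
Definition numeral_check (w : seq symbol) (p q c : nat) : bool :=
  if c == 0 then (nth None w p == Some false) && (q == p.+1)
  else foldl (fun c k => if (p <= k) && (k < q)
                         then digit_step (size w) c (nth None w k) else c)
         c (iota 0 (size w)) == 0.

Lemma decp_symbol d x b : x < d ->
  decp d (fun w e => nth None w (nth 0 e x) == Some b).
Proof.
move=> xd; apply: decp_ext (decp_sym (Some b) xd) => w e _ _.
by case: ltnP => //= le; rewrite nth_default.
Qed.

Lemma decp_numeral d x y z : x < d -> y < d -> z < d ->
  decp d (fun w e => numeral_check w (nth 0 e x) (nth 0 e y) (nth 0 e z)).
Proof.
move=> xd yd zd.
pose s (w : seq symbol) (e : seq nat) :=
  if (nth 0 e x <= nth 0 e d.+1) && (nth 0 e d.+1 < nth 0 e y)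
  then digit_step (size w) (nth 0 e d) (nth None w (nth 0 e d.+1)) else nth 0 e d.
have Hs : fn d.+2 s.
  split=> [w e se be|].
    have := bounded_nth d be; rewrite /s /digit_step.
    by case: ifP => // _; case: ifP => // _; lia.
  have B : decp d.+3 (fun _ e => (nth 0 e x <= nth 0 e d.+1) && (nth 0 e d.+1 < nth 0 e y)).
    by apply: decp_and; [apply: decp_leq | apply: decp_lt]; lia.
  have O : decp d.+3 (fun w e => nth None w (nth 0 e d.+1) == Some (odd (nth 0 e d))).
    apply: decp_ext (decp_if (@decp_odd d.+3 d _) (@decp_symbol d.+3 d.+1 true _)
      (@decp_symbol d.+3 d.+1 false _)); [|lia|lia|lia].
    by move=> w e _ _; case: (odd _).
  have C : decp d.+3 (fun w e => [|| nth 0 e d == size w, nth 0 e d == 0 |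
      nth None w (nth 0 e d.+1) != Some (odd (nth 0 e d))]).
    apply: decp_or.
      apply: decp_ext (decp_not (@decp_inside d.+3 d _)); last by lia.
      by move=> w e _ be; have := bounded_nth d be; lia.
    by apply: decp_or; [apply: decp_zero; lia | apply: decp_not].
  have F : decp d.+3 (fun w e => size w == nth 0 e d.+2).
    apply: decp_ext (decp_not (@decp_inside d.+3 d.+2 _)); last by lia.
    by move=> w e _ be; have := bounded_nth d.+2 be; lia.
  have G : decp d.+3 (fun w e => (nth 0 e d)./2 == nth 0 e d.+2).
    by apply: decp_half; lia.
  have Q : decp d.+3 (fun w e => nth 0 e d == nth 0 e d.+2) by apply: decp_eq; lia.
  apply: decp_ext (decp_if B (decp_if C F G) Q) => w e se be; rewrite /s.
  rewrite !nth_take //; try lia.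
  by rewrite /digit_step; case: ifP => // _; case: ifP.
have T0 : fn d (fun _ e => nth 0 e z).
  split=> [w e _ be|]; first exact: bounded_nth.
  apply: decp_ext (@decp_eq d.+1 z d _ _) => [w e _ _||//]; first by rewrite nth_take.
  exact: ltnW.
have Z := decp_push (fn_fold T0 Hs) (decp_zero (ltnSn d)).
have E : decp d (fun w e => (nth None w (nth 0 e x) == Some false) &&
   (nth 0 e y == (nth 0 e x).+1)).
  by apply: decp_and; [apply: decp_symbol | apply: decp_succ].
apply: decp_ext (decp_if (decp_zero zd) E Z) => w e se be.
rewrite /numeral_check; case: ifP => // _; rewrite (nth_rcons_eq _ se); congr (_ == _).
elim: (iota _ _) (nth 0 e z) => //= k l IH c; rewrite IH; congr foldl.
have nE i : nth 0 (e ++ [:: c; k]) (d + i) = nth 0 [:: c; k] i.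
  by rewrite nth_cat se ltnNge leq_addr addKn.
by rewrite /s; move: (nE 0) (nE 1); rewrite addn0 addn1 => -> ->; rewrite !nth_cat se xd yd.
Qed.

Lemma bits_gt0 k : 0 < k ->
  bits k = odd k :: (if k./2 == 0 then [::] else bits k./2).
Proof.
move=> k0; rewrite /bits /mkseq /= expn0 divn1; congr cons.
have [k1|k1] := ltnP 1 k; last first.
  by have -> : k = 1 by lia.
rewrite ifN; last by lia.
rewrite trunc_log2S // -[1]addn0 iotaDl -map_comp; apply: eq_map => j /=.
by rewrite add1n expnS divnMA divn2.
Qed.

Lemma foldl_digit_step N c (b : seq (option bool)) : c < N ->
  (foldl (digit_step N) c b == 0) = (b == if c == 0 then [::] else map Some (bits c)).
Proof.
have stuck l : foldl (digit_step N) N l = N.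
  by elim: l => //= x l IH; rewrite {2}/digit_step eqxx.
elim: b c => [|x b IH] c cN; first by rewrite /=; case: eqP.
rewrite [foldl _ _ _]/= {2}/digit_step (ltn_eqF cN) orFb.
case: (posnP c) => [_|c0].
  by rewrite orTb stuck (gtn_eqF (leq_ltn_trans (leq0n c) cN)).
rewrite orFb bits_gt0 // map_cons eqseq_cons; case: (eqVneq x (Some (odd c))) => _.
  by rewrite IH; [case: ifP | lia].
by rewrite stuck (gtn_eqF (leq_ltn_trans (leq0n c) cN)).
Qed.

(** The recursion available to formulas runs over all positions; the guard makes the positions
    outside the block idle. *)
Lemma foldl_slice (h : nat -> option bool -> nat) (w : seq symbol) p q c :
  p <= q -> q <= size w ->
  foldl (fun c k => if (p <= k) && (k < q) then h c (nth None w k) else c)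
    c (iota 0 (size w)) = foldl h c (take (q - p) (drop p w)).
Proof.
move=> pq qN.
have -> : size w = p + ((q - p) + (size w - q)) by lia.
rewrite !iotaD !foldl_cat add0n.
have out s z : {in s, forall k, (k < p) || (q <= k)} ->
   foldl (fun c k => if (p <= k) && (k < q) then h c (nth None w k) else c) z s = z.
  elim: s z => //= k s IH z H; rewrite ifN; last by have := H k (mem_head _ _); lia.
  by apply: IH => i /(mem_behead (s := k :: s))/H.
rewrite [foldl _ c (iota 0 p)]out; last by move=> k; rewrite mem_iota; lia.
rewrite out; last by move=> k; rewrite mem_iota; lia.
have -> : take (q - p) (drop p w) = map (nth None w) (iota p (q - p)).
  by rewrite map_nth_iota // leq_sub2r.
have : {in iota p (q - p), forall k, (p <= k) && (k < q)} by move=> k; rewrite mem_iota; lia.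
elim: (iota p (q - p)) c => //= k s IH c H; rewrite H ?mem_head //.
by apply: IH => i /(mem_behead (s := k :: s))/H.
Qed.

(** Zero is treated apart because its numeral is a single 0, whereas stripping digits off 0 would
    accept the empty block. The bound on [c] separates genuine values from the failure value
    [size w]. *)
Lemma numeral_checkP w p q c : p <= q -> q <= size w -> c < size w ->
  numeral_check w p q c = (take (q - p) (drop p w) == map Some (bits c)).
Proof.
move=> pq qN cN; rewrite /numeral_check; case: eqVneq => [->|c0]; last first.
  by rewrite foldl_slice // foldl_digit_step // (negbTE c0).
have -> : bits 0 = [:: false] by [].
have st : size (take (q - p) (drop p w)) = q - p.
  by rewrite size_takel // size_drop; lia.
have ts i : i < q - p -> nth None (take (q - p) (drop p w)) i = nth None w (p + i).
  by move=> lt; rewrite nth_take // nth_drop.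
apply/andP/eqP => [[/eqP h /eqP E]|E].
  apply: (@eq_from_nth _ None) => [|i]; first by rewrite st /=; lia.
  rewrite st => lt; rewrite ts //; have -> : i = 0 by lia.
  by rewrite addn0 h.
have q1 : q - p = 1 by rewrite -st E.
split; last by apply/eqP; lia.
by have := ts 0; rewrite E q1 addn0 => <-.
Qed.

(** * Allocations and words *)

Lemma count_ltn m N (P : pred nat) : m <= N ->
  count (fun g => (g < m) && P g) (iota 0 N) = #|[set g : 'I_m | P g]|.
Proof.
move=> le; rewrite -(subnKC le) iotaD count_cat add0n.
rewrite [X in _ + X](_ : _ = 0) ?addn0; last first.
  apply/eqP; rewrite -leqn0 leqNgt -has_count; apply/hasPn => k.
  by rewrite mem_iota; lia.
rewrite cardsE cardE /enum_mem size_filter -enumT -val_enum_ord count_map.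
by apply: eq_count => g /=; rewrite ltn_ord.
Qed.

Lemma card_fibers (I J : finType) (h : I -> J) (P : pred I) :
  #|[set g | P g]| = \sum_(j : J) #|[set g | P g && (h g == j)]|.
Proof.
rewrite -sum1_card (partition_big h predT) //=; apply: eq_bigr => j _.
by rewrite -sum1_card; apply: eq_bigl => g; rewrite !inE.
Qed.

(** Turns a bound on ranks into a bound on positions: as [f] is monotone, the [g] with [X <= f g]
    form a final segment. *)
Lemma threshold (f : nat -> nat) m X : {homo f : a b / a <= b} ->
  exists2 y, y <= m & forall g, g < m -> (y <= g) = (X <= f g).
Proof.
move=> mono; exists (find (fun g => X <= f g) (iota 0 m)); first exact: find_iota_leq.
move=> g lt; apply/idP/idP => [le|le].
  apply: leq_trans (mono _ _ le).
  by apply: (@find_iotaP (fun g => X <= f g)); apply: leq_ltn_trans lt.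
by rewrite leqNgt; apply/negP => /before_find_iota; rewrite le.
Qed.

(** [count P (iota 0 g)] is the rank of [g] in [P], and the elements of [P] below [m] take each rank
    below their number exactly once. *)
Lemma count_rank_between (P : pred nat) a b m :
  count (fun g => P g && (a <= count P (iota 0 g) < b)) (iota 0 m) =
  minn b (count P (iota 0 m)) - minn a (count P (iota 0 m)).
Proof.
elim: m => [|m IH]; first by rewrite /= !minn0.
rewrite -addn1 iotaD !count_cat IH /= !addn0 add0n.
case: (P m) => /=; last by rewrite !addn0.
set c := count P _; case: (leqP a c) => h1; case: (ltnP c b) => h2 /=; lia.
Qed.

Lemma interval_index (X : nat -> nat) n r : X 0 <= r < X n ->
  exists2 j, j < n & X j <= r < X j.+1.
Proof.
elim: n => [|n IH] /andP[h0 hn]; first by move: (leq_ltn_trans h0 hn); rewrite ltnn.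
case: (ltnP r (X n)) => h; last by exists n; rewrite ?h.
by have [|j lt hj] := IH; [rewrite h0 | exists j; rewrite // ltnW].
Qed.

(* Goods of the same type are interchangeable, so each agent may be given an
   interval of the goods of each type. *)
Lemma sort_owners m n (T : finType) (typ : 'I_m -> T) (a : 'I_m -> 'I_n) :
  exists lo hi : T -> 'I_n -> nat,
  [/\ forall t j, lo t j <= m /\ hi t j <= m,
      forall g, #|[set j | lo (typ g) j <= g < hi (typ g) j]| = 1 &
      forall t j, #|[set g : 'I_m | (typ g == t) && (lo (typ g) j <= g < hi (typ g) j)]| =
                  #|[set g | (typ g == t) && (a g == j)]|].
Proof.
pose P t (k : nat) := if insub k is Some g then typ g == t else false.
have PE t (g : 'I_m) : P t g = (typ g == t) by rewrite /P valK.
pose f t k := count (P t) (iota 0 k).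
have fS t k : f t k.+1 = f t k + P t k by rewrite /f -addn1 iotaD count_cat /= addn0.
have f_homo t : {homo f t : b c / b <= c}.
  by move=> b c le; rewrite /f -(subnKC le) iotaD count_cat leq_addr.
have fm t : f t m = #|[set g | typ g == t]|.
  have := count_ltn (P t) (leqnn m); under eq_finset => g do rewrite PE.
  move=> <-; apply: eq_in_count => k; rewrite mem_iota0 => ->; by [].
(* The partial sums [X t] of the holdings [x t j] cut the ranks within type [t] into consecutive
   intervals, one for each agent. *)
pose x t j := #|[set g | (typ g == t) && (a g == j)]|.
pose X t k := \sum_(j < n | j < k) x t j.
have XS t (j : 'I_n) : X t j.+1 = X t j + x t j.
  rewrite /X (bigD1 j) //= addnC; congr addn; apply: eq_bigl => i.
  by rewrite ltnS ltn_neqAle andbC.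
have X0 t : X t 0 = 0 by rewrite /X big_pred0.
have Xn t : X t n = f t m.
  rewrite fm (card_fibers a); apply: eq_bigl => j; exact: ltn_ord.
have X_homo t : {homo X t : b c / b <= c}.
  move=> b c le; rewrite /X [leqRHS]big_mkcond [leqLHS]big_mkcond; apply: leq_sum => j _.
  by case: ifP => // h; rewrite (leq_trans h le).
(* A boolean formulation, so that [xchoose] yields the thresholds as a function of [t] and [k]. *)
have th t k : exists y, (y <= m) && [forall g : 'I_m, (y <= g) == (X t k <= f t g)].
  have [y le h] := threshold m (X t k) (f_homo t).
  by exists y; rewrite le; apply/forallP => g; rewrite h.
pose Y t k := xchoose (th t k).
have Ym t k : Y t k <= m by case/andP: (xchooseP (th t k)).
have YE t k (g : 'I_m) : (Y t k <= g) = (X t k <= f t g).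
  by case/andP: (xchooseP (th t k)) => _ /forallP/(_ g)/eqP.
exists (fun t j => Y t j), (fun t j => Y t j.+1); split=> [t j|g|t j]; first by [].
  (* As [g] itself counts towards its type, its rank is below the total, so one of the intervals
     contains it. *)
  have ltf : f (typ g) g < X (typ g) n.
    rewrite Xn; apply: leq_trans (f_homo _ g.+1 m (ltn_ord g)).
    by rewrite fS PE eqxx addn1.
  have [|k ltk hk] := @interval_index (X (typ g)) n (f (typ g) g); first by rewrite X0.
  rewrite (_ : [set _ | _] = [set Ordinal ltk]) ?cards1 //.
  apply/setP => j; rewrite !inE !(ltnNge g) !YE -ltnNge.
  apply/idP/eqP => [hj|-> //]; apply/val_inj/eqP; rewrite /= eqn_leq.
  case: (ltngtP j k) => // lt.
    by have := X_homo (typ g) j.+1 k lt; lia.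
  by have := X_homo (typ g) k.+1 j lt; lia.
rewrite -[RHS]/(x t j); have -> : x t j = minn (X t j.+1) (f t m) - minn (X t j) (f t m).
  have le1 : X t j.+1 <= f t m by rewrite -Xn X_homo.
  have le2 : X t j <= f t m by rewrite (leq_trans _ le1) // X_homo.
  by rewrite (minn_idPl le1) (minn_idPl le2) XS addKn.
rewrite -count_rank_between.
rewrite (_ : count _ _ = count (fun g => (g < m) &&
    (P t g && (X t j <= f t g < X t j.+1))) (iota 0 m)).
  rewrite count_ltn //; apply: eq_card => g; rewrite !inE PE !(ltnNge g) !YE -ltnNge.
  by case: eqP => // ->.
by apply: eq_in_count => k; rewrite mem_iota0 => ->.
Qed.

(** * EF1 under binary utilities *)

Section Binary.
Variables (R : realType) (n : nat) (I : instance R n).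

Definition desired (i : 'I_n) (S : {set 'I_(goods I)}) : nat :=
  #|[set g in S | value i g == 1%R]|.

Hypothesis binI : binary I.

Lemma utility_binary i S : utility i S = (desired i S)%:R%R.
Proof.
rewrite /utility /desired -sum1_card GRing.natr_sum [RHS]big_mkcond [LHS]big_mkcond /=.
apply: eq_bigr => g _; rewrite !inE; case: (g \in S) => //=.
by case: (binI i g) => ->; rewrite ?eqxx // eq_sym GRing.oner_eq0.
Qed.

(* The good removed from the bundle of [j] may be chosen among those that [i]
   desires. *)
Lemma EF1_towards_binary (A : {ffun 'I_n -> {set 'I_(goods I)}}) i j :
  EF1_towards A i j <-> desired i (A j) <= (desired i (A i)).+1.
Proof.
have D1 g : g \in A j -> desired i (A j) = (value i g == 1%R) + desired i (A j :\ g).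
  move=> gA; rewrite /desired (cardsD1 g) inE gA /=; congr addn.
  by apply: eq_card => h; rewrite !inE andbA.
split=> [[->|[g gA]]|le].
- by rewrite /desired (_ : [set _ in _ | _] = set0) ?cards0 //; apply/setP=> g; rewrite !inE.
- by rewrite !utility_binary Num.Theory.ler_nat (D1 g gA); case: (_ == _); lia.
case: (set_0Vmem (A j)) => [Aj0|[g0 g0A]]; first by left.
right; case: (set_0Vmem [set g in A j | value i g == 1%R]) => [E|[g]].
  exists g0; rewrite // !utility_binary Num.Theory.ler_nat.
  have : desired i (A j) = 0 by rewrite /desired E cards0.
  by rewrite (D1 g0 g0A); lia.
rewrite inE => /andP[gA v1]; exists g; rewrite // !utility_binary Num.Theory.ler_nat.
by move: le; rewrite (D1 g gA) v1 add1n ltnS.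
Qed.

End Binary.

(** * Words as sequences of separated blocks *)

Definition block_start (bs : seq (seq bool)) i := size (flatten (map block (take i bs))).

Lemma drop_block_start bs i :
  drop (block_start bs i) (flatten (map block bs)) = flatten (map block (drop i bs)).
Proof.
by rewrite -{2}(cat_take_drop i bs) map_cat flatten_cat drop_size_cat.
Qed.

Definition laid_out (w : seq symbol) (p q : nat -> nat) (bs : seq (seq bool)) i :=
  [/\ q i = p i + size (nth [::] bs i), q i < size w,
      take (q i - p i) (drop (p i) w) = map Some (nth [::] bs i) &
      nth None w (q i) = None].

Lemma laid_out_blocks bs i (w := flatten (map block bs))
    (p := block_start bs) (q := fun i => p i + size (nth [::] bs i)) :
  i < size bs -> laid_out w p q bs i /\ p i.+1 = (q i).+1.
Proof.
move=> lt; have E : drop (p i) w = map Some (nth [::] bs i) ++ None ::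
    flatten (map block (drop i.+1 bs)).
  by rewrite drop_block_start (drop_nth [::]) //= /block cat_rcons.
have lw : q i < size w.
  have := congr1 size E; rewrite size_drop size_cat /= size_map /q; lia.
split; last first.
  rewrite /q /p /block_start (take_nth [::]) // map_rcons flatten_rcons size_cat.
  by rewrite /block size_rcons size_map addnS.
split=> //; rewrite /q; first by rewrite addKn E take_size_cat // size_map.
by rewrite -nth_drop E nth_cat size_map ltnn subnn.
Qed.

(** By induction on [k], the prefix of [w] through the separator of block [k] is the concatenation
    of the first [k.+1] blocks; the last separator ends [w], so nothing follows. *)
Lemma blocks_of_layout w p q bs :
  p 0 = 0 -> (forall i, i < size bs -> laid_out w p q bs i) ->
  (forall i, i.+1 < size bs -> p i.+1 = (q i).+1) ->
  0 < size bs -> (q (size bs).-1).+1 = size w ->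
  w = flatten (map block bs).
Proof.
move=> p0 H S b0 E.
have : forall k, k < size bs ->
  take (q k).+1 w = flatten (map block (take k.+1 bs)) /\ p k = block_start bs k.
  have step k : k < size bs -> take (p k) w = flatten (map block (take k bs)) ->
    take (q k).+1 w = flatten (map block (take k.+1 bs)).
    move=> lt IH; have [qE qw ts ns] := H k lt.
    rewrite (take_nth None) // ns (take_nth [::]) // map_rcons flatten_rcons -IH.
    rewrite /block -ts -rcons_cat; congr rcons.
    have -> : q k = p k + (q k - p k) by lia.
    by rewrite takeD addKn.
  elim=> [|k IH] lt.
    by split; [apply: step; rewrite // p0 !take0 | rewrite p0 /block_start take0].
  have [tk _] := IH (ltnW lt).
  split; first by apply: step; rewrite // S.
  by rewrite S // /block_start -tk size_takel //; have [] := H k (ltnW lt).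
move=> /(_ (size bs).-1); rewrite prednK // E take_size take_size => -[] //.
Qed.

(** * The certificate *)

Section Accept.
Variable n : nat.

Definition bit (w : seq symbol) (p : nat -> nat) (i g : nat) : bool :=
  nth None w (p i + g) == Some true.

Definition profile w p g : {ffun 'I_n -> bool} := [ffun i : 'I_n => bit w p i g].

Section Certificate.
Variables (w : seq symbol) (m : nat) (p q : nat -> nat).
Variables (lo hi : {ffun 'I_n -> bool} -> 'I_n -> nat).

Definition own g j : bool := lo (profile w p g) j <= g < hi (profile w p g) j.

Definition share j := count (fun g => (g < m) && own g j) (iota 0 (size w)).

Definition worth (i j : 'I_n) :=
  count (fun g => (g < m) && (bit w p i g && own g j)) (iota 0 (size w)).

(* [p i] and [q i] are the first position of the [i]-th block and the position
   of the separator closing it; agent [j] receives the goods of type [t] in the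
   interval from [lo t j] to [hi t j]. *)
Definition accept : bool :=
  [&& 0 < m, p 0 == 0, (q (n + n).-1).+1 == size w,
      [forall i : 'I_(n + n).-1, p i.+1 == (q i).+1],
      [forall i : 'I_(n + n),
         (p i <= q i) && ((q i < size w) && (nth None w (q i) == None))],
      [forall i : 'I_n, (p i + m == q i) &&
         ~~ has (fun u => ((p i <= u) && (u < q i)) &&
                   ((u < size w) && (nth None w u == None))) (iota 0 (size w).+1)],
      [forall j : 'I_n, numeral_check w (p (n + j)) (q (n + j)) (share j)],
      ~~ has (fun g => (g < m) && (#|[set j | own g j]| != 1)) (iota 0 (size w).+1) &
      [forall i : 'I_n, forall j : 'I_n, worth i j <= (worth i i).+1]].

End Certificate.

Lemma flatten_encode (R : realType) (I : instance R n) (s : {ffun 'I_n -> nat}) :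
  encode I s = flatten (map block
    ([seq [seq value i g == 1%R | g <- enum 'I_(goods I)] | i <- enum 'I_n] ++
     [seq bits (s i) | i <- enum 'I_n])).
Proof. by rewrite /encode map_cat flatten_cat -!map_comp. Qed.

Variable R : realType.
Hypothesis n_gt1 : 2 <= n.

Lemma accept_sound w m p q lo hi :
  accept w m p q lo hi -> binary_reformability R n w.
Proof.
case/and5P => m0 /eqP p0 /eqP qN /forallP pS /and5P[/forallP H /forallP rows
  /forallP nums /hasPn owner /forallP fair].
(* The first row has length [m] and is followed by its separator. *)
have mq0 : m < size w.
  have n0 : 0 < n by lia.
  have n0' : 0 < n + n by lia.
  have /andP[/eqP E _] := rows (Ordinal n0); rewrite /= in E.
  by have /andP[_ /andP[/= lt _]] := H (Ordinal n0'); lia.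
pose v (i : 'I_n) (g : 'I_m) : R := (bit w p i g)%:R%R.
have v0 i g : (0 <= v i g)%R by rewrite /v Num.Theory.ler0n.
pose I := Instance m0 v0.
(* The size vector is defined from the certificate; the numeral check then shows that it is the one
   written in [w]. *)
pose s : {ffun 'I_n -> nat} := [ffun j => share w m p lo hi j].
pose A : {ffun 'I_n -> {set 'I_m}} := [ffun j => [set g : 'I_m | own w p lo hi g j]].
have vE i g : (@value R n I i g == 1%R) = bit w p i g.
  by rewrite /= /v; case: bit; rewrite ?eqxx // eq_sym GRing.oner_eq0.
have binI : binary I by move=> i g; rewrite /= /v; case: bit; [right | left].
have own1 (g : 'I_m) : exists j, forall k, own w p lo hi g k = (k == j).
  have := owner g; rewrite mem_iota0 ltnS (leq_trans (ltnW (ltn_ord g)) (ltnW mq0)).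
  move=> /(_ isT); rewrite ltn_ord /= negbK => /cards1P[j E].
  by exists j => k; move/setP/(_ k): E; rewrite !inE.
have cardA j : #|A j| = s j.
  by rewrite !ffunE /share count_ltn // ltnW.
have disjA j k : j != k -> [disjoint A j & A k].
  move=> jk; rewrite -setI_eq0; apply/eqP/setP => g; rewrite !ffunE !inE.
  have [l E] := own1 g; rewrite !E; case: eqP => // <-; by rewrite eq_sym (negbTE jk).
have coverA : \bigcup_j A j = [set: 'I_m].
  apply/setP => g; rewrite inE; apply/bigcupP; have [j E] := own1 g.
  by exists j; rewrite // ffunE inE E.
exists I, s; split=> //.
- rewrite /is_size_vector /=; under eq_bigr => j _ do rewrite -cardA.
  rewrite -[RHS]card_ord -cardsT -coverA -[RHS]sum1_card partition_disjoint_bigcup //.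
  by apply: eq_bigr => j _; rewrite sum1_card.
- rewrite flatten_encode; set bs := _ ++ _.
  have sb : size bs = n + n by rewrite size_cat size_map size_map size_enum_ord.
  apply: (@blocks_of_layout w p q bs); rewrite ?sb //; try lia.
    move=> i lt; have /andP[le /andP[qw /eqP ns]] := H (Ordinal lt); rewrite /= in le qw ns.
    have E : take (q i - p i) (drop (p i) w) = map Some (nth [::] bs i).
      case: (ltnP i n) => ltn.
        rewrite nth_cat size_map size_enum_ord ltn (nth_map (Ordinal ltn)) ?size_enum_ord //.
        have -> : nth (Ordinal ltn) (enum 'I_n) i = Ordinal ltn.
          by apply: val_inj; rewrite /= nth_enum_ord.
        have /andP[/eqP E /hasPn no] := rows (Ordinal ltn); rewrite /= in E.
        have qp : q i - p i = m by lia.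
        have st : size (take m (drop (p i) w)) = m.
          by rewrite size_takel // size_drop -qp leq_sub2r // ltnW.
        rewrite qp; apply: (@eq_from_nth _ None) => [|g]; rewrite st.
          by rewrite size_map size_map size_enum_ord.
        move=> ltg; rewrite nth_take // nth_drop.
        rewrite (nth_map false); last by rewrite size_map size_enum_ord.
        rewrite (nth_map (Ordinal ltg)) ?size_enum_ord // vE nth_enum_ord // /bit /=.
        have lq : p i + g < q i by lia.
        have lw : p i + g < size w by apply: ltn_trans lq qw.
        move: (no (p i + g)); rewrite mem_iota0 ltnS (ltnW lw) leq_addr lq lw /=.
        by move=> /(_ isT); case: (nth None w (p i + g)) => // -[].
      have ltj : i - n < n by lia.
      rewrite nth_cat size_map size_enum_ord ltnNge ltn /=.
      rewrite (nth_map (Ordinal ltj)) ?size_enum_ord //.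
      have -> : nth (Ordinal ltj) (enum 'I_n) (i - n) = Ordinal ltj.
        by apply: val_inj; rewrite /= nth_enum_ord.
      have := nums (Ordinal ltj); rewrite /= subnKC // numeral_checkP ?(ltnW qw) //.
        by rewrite ffunE => /eqP.
      have <- : s (Ordinal ltj) = share w m p lo hi (Ordinal ltj) by rewrite ffunE.
      rewrite -cardA.
      by apply: leq_ltn_trans mq0; rewrite -[leqRHS]card_ord max_card.
    have qE : q i = p i + size (nth [::] bs i).
      by rewrite -(size_map Some) -E size_takel ?subnKC // size_drop leq_sub2r // ltnW.
    by split.
  move=> i lt; apply/eqP.
  have lt' : i < (n + n).-1 by lia.
  exact: (pS (Ordinal lt')).
- exists A; split=> // i j ij; apply/EF1_towards_binary => //.
  have W k : @desired R n I i (A k) = worth w m p lo hi i k.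
    rewrite /worth count_ltn; last exact: ltnW.
    apply: eq_card => g; rewrite !inE vE !ffunE inE.
    exact: andbC.
  by rewrite !W; have /forallP := fair i; apply.
Qed.

Lemma accept_complete w : binary_reformability R n w ->
  exists m p q lo hi,
  [/\ m <= size w, forall i, i < n + n -> p i <= size w /\ q i <= size w,
      forall t j, lo t j <= size w /\ hi t j <= size w & accept w m p q lo hi].
Proof.
case=> I [s [binI _ wE [A [[disjA coverA] sizeA EF1A]]]].
set m := goods I in A disjA coverA sizeA EF1A *.
rewrite flatten_encode in wE; set bs := _ ++ _ in wE.
have sb : size bs = n + n by rewrite size_cat size_map size_map size_enum_ord.
pose p := block_start bs; pose q i := p i + size (nth [::] bs i).
have lay i : i < n + n -> laid_out w p q bs i /\ p i.+1 = (q i).+1.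
  by move=> lt; rewrite wE; apply: laid_out_blocks; rewrite sb.
have rowE (i : 'I_n) : nth [::] bs i = [seq value i g == 1%R | g <- enum 'I_m].
  rewrite nth_cat size_map size_enum_ord ltn_ord (nth_map i) ?size_enum_ord //.
  by congr map; rewrite nth_ord_enum.
have numE (j : 'I_n) : nth [::] bs (n + j) = bits (s j).
  rewrite nth_cat size_map size_enum_ord ltnNge leq_addr addKn /=.
  by rewrite (nth_map j) ?size_enum_ord // nth_ord_enum.
have nthE (i : 'I_n) g : g < m ->
    nth None w (p i + g) = Some (nth false (nth [::] bs i) g).
  move=> lt; have [[qE _ E _] _] := lay i (ltn_addr _ (ltn_ord i)).
  have ltb : g < size (nth [::] bs i) by rewrite rowE size_map size_enum_ord.
  by rewrite -nth_drop -(@nth_take (q i - p i)) ?E ?(nth_map false) // qE addKn.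
have bitE (i : 'I_n) (g : 'I_m) : bit w p i g = (value i g == 1%R).
  rewrite /bit nthE // rowE (nth_map g) ?size_enum_ord // nth_ord_enum.
  by rewrite (inj_eq Some_inj) eqb_id.
have qi (i : 'I_n) : p i + m = q i by rewrite /q rowE size_map size_enum_ord.
have mw : m < size w.
  have n0 : 0 < n by lia.
  have [[_ lt _ _] _] := lay 0 (ltn_addr _ n0).
  by apply: leq_ltn_trans lt; rewrite -(qi (Ordinal n0)) leq_addl.
have ex g : exists j, g \in A j.
  have : g \in \bigcup_j A j by rewrite coverA inE.
  by case/bigcupP => j _ gA; exists j.
pose a g := xchoose (ex g).
have aE g j : (g \in A j) = (a g == j).
  apply/idP/eqP => [gA|<-]; last exact: (xchooseP (ex g)).
  case: (eqVneq (a g) j) => // /disjA/disjoint_setI0/setP/(_ g).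
  by rewrite !inE gA (xchooseP (ex g)).
have [lo [hi [lohi own1 ownE]]] := sort_owners (fun g : 'I_m => profile w p g) a.
(* Sorting preserves every count that depends on types only. [Q] constantly true gives the bundle
   sizes, and [Q t = t i] the numbers of goods desired by [i]. *)
have countE (Q : {ffun 'I_n -> bool} -> bool) j :
    #|[set g : 'I_m | Q (profile w p g) && own w p lo hi g j]| =
    #|[set g : 'I_m | Q (profile w p g) && (a g == j)]|.
  rewrite (card_fibers (fun g : 'I_m => profile w p g)).
  rewrite [RHS](card_fibers (fun g : 'I_m => profile w p g)).
  apply: eq_bigr => t _; case: (boolP (Q t)) => Qt; last first.
    by rewrite !eq_card0 // => g; rewrite !inE; case: (eqVneq (profile w p g) t) => [->|_];
      rewrite ?andbF ?(negbTE Qt).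
  transitivity #|[set g : 'I_m | (profile w p g == t) && own w p lo hi g j]|.
    apply: eq_card => g; rewrite !inE andbC.
    by case: (eqVneq (profile w p g) t) => [->|_]; rewrite ?Qt.
  rewrite ownE; apply: eq_card => g; rewrite !inE.
  by rewrite [RHS]andbC; case: (eqVneq (profile w p g) t) => [->|_]; rewrite ?Qt.
have shareE j : share w m p lo hi j = s j.
  rewrite /share count_ltn; last exact: ltnW.
  by rewrite (countE predT) -sizeA; apply: eq_card => g; rewrite !inE aE.
have worthE i j : worth w m p lo hi i j = desired i (A j).
  rewrite /worth count_ltn; last exact: ltnW.
  have := countE (fun t => t i) j.
  rewrite (_ : [set g : 'I_m | profile w p g i && _] =
    [set g : 'I_m | bit w p i g && own w p lo hi g j]); last first.
    by apply/setP => g; rewrite !inE ffunE.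
  by move=> ->; apply: eq_card => g; rewrite !inE ffunE bitE aE andbC.
exists m, p, q, lo, hi; split=> [|i lt|t j|]; first exact: ltnW.
- have [[_ lq _ _] _] := lay i lt; split; last exact: ltnW.
  by apply: leq_trans (ltnW lq); apply: leq_addr.
- by have [l h] := lohi t j; split; [apply: leq_trans l _ | apply: leq_trans h _]; apply: ltnW.
have nn : (n + n).-1 < n + n by lia.
rewrite /accept; apply/and5P; split.
- exact: goods_gt0.
- by rewrite /p /block_start take0.
- have [_ <-] := lay _ nn; rewrite prednK; last by lia.
  by rewrite /p /block_start -sb take_size wE.
- apply/forallP => i; apply/eqP; have [|_] := lay i; last by [].
  by have := ltn_ord i; lia.
apply/and5P; split.
- apply/forallP => i; have [[_ -> _ ->] _] := lay i (ltn_ord i).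
  by rewrite leq_addr eqxx.
- apply/forallP => i; rewrite qi eqxx andTb; apply/hasPn => u _.
  apply/negP => /andP[/andP[pu uq]].
  have lt : u - p i < m by rewrite -(qi i) in uq; lia.
  by have := nthE i _ lt; rewrite subnKC // => ->; rewrite andbF.
- apply/forallP => j; have lt : n + j < n + n by rewrite ltn_add2l.
  have [[_ lq E _] _] := lay _ lt.
  rewrite shareE numeral_checkP ?E ?numE ?leq_addr ?(ltnW lq) //.
  by apply: leq_ltn_trans mw; rewrite -sizeA -[leqRHS]card_ord max_card.
- apply/hasPn => g _; apply/negP => /andP[lt].
  by rewrite (own1 (Ordinal lt)).
apply/forallP => i; apply/forallP => j; rewrite !worthE.
case: (eqVneq i j) => [->|ij]; first exact: leqnSn.
exact/(EF1_towards_binary binI)/EF1A.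
Qed.

End Accept.

(** * Evaluating the certificate *)

Lemma decp_has d (Q : seq symbol -> seq nat -> nat -> bool) :
  decp d.+1 (fun w e => Q w (take d e) (nth 0 e d)) ->
  decp d (fun w e => has (Q w e) (iota 0 (size w).+1)).
Proof.
move=> H; apply: decp_ext (decp_ex H) => w e se _.
by apply: eq_has => k; rewrite take_rcons_eq // nth_rcons_eq.
Qed.

Lemma fn_count_take d (Q : seq symbol -> seq nat -> nat -> bool) :
  decp d.+1 (fun w e => Q w (take d e) (nth 0 e d)) ->
  fn d (fun w e => count (Q w e) (iota 0 (size w))).
Proof.
move=> H; have [b g] := fn_count H.
have E w e : size e = d -> count (fun k => Q w (take d (rcons e k)) (nth 0 (rcons e k) d))
    (iota 0 (size w)) = count (Q w e) (iota 0 (size w)).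
  by move=> se; apply: eq_count => k; rewrite take_rcons_eq // nth_rcons_eq.
split=> [w e se be|]; first by rewrite -E // b.
by apply: decp_ext g => w e se be; rewrite E // size_takel // se.
Qed.

Lemma fn_weaken d t : fn d t -> fn d.+1 (fun w e => t w (take d e)).
Proof.
move=> [bt gt]; split=> [w e se be|].
  by apply: bt; [rewrite size_takel ?se | apply: bounded_take].
apply: decp_ext (decp_ren (s := rcons (iota 0 d) d.+1) (d' := d.+2) _ _ gt).
- move=> w e se be; rewrite /pick map_rcons -/(pick _ _) pick_iota ?se //; last by lia.
  have st : size (take d e) = d by rewrite size_takel // se; lia.
  by rewrite take_rcons_eq // nth_rcons_eq // take_takel.
- by rewrite size_rcons size_iota.
- by rewrite all_rcons ltnSn; apply/allP => i; rewrite mem_iota; lia.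
Qed.

Lemma decp_leq_succ d s t : fn d s -> fn d t ->
  decp d (fun w e => s w e <= (t w e).+1).
Proof.
move=> Hs Ht.
have L : decp d.+2 (fun _ e =>
    (nth 0 e d <= nth 0 e d.+1) || (nth 0 e d == (nth 0 e d.+1).+1)).
  by apply: decp_or; [apply: decp_leq | apply: decp_succ].
apply: decp_ext (decp_push Hs (decp_push (fn_weaken Ht) L)) => w e se be.
have se1 : size (rcons e (s w e)) = d.+1 by rewrite size_rcons se.
rewrite take_rcons_eq // (nth_rcons_eq _ se1) nth_rcons se1 ltnSn nth_rcons_eq //.
by rewrite [in RHS]leq_eqVlt ltnS orbC.
Qed.

Lemma decp_bit d x y : x < d -> y < d ->
  decp d (fun w e => nth None w (nth 0 e x + nth 0 e y) == Some true).
Proof.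
move=> xd yd.
have H : decp d.+1 (fun w e => (nth 0 e x + nth 0 e y == nth 0 e d) &&
    (nth None w (nth 0 e d) == Some true)).
  by apply: decp_and; [apply: decp_add | apply: decp_symbol]; rewrite // ltnW.
apply: (decp_exists H) => w e se be; split=> [h|[k [_]]].
  exists (nth 0 e x + nth 0 e y).
  rewrite (nth_rcons_eq _ se) !nth_rcons se xd yd eqxx; split=> //.
  (* A position past the end reads [None], so the sum is in range whenever the bit is set. *)
  by rewrite leqNgt; apply/negP => /ltnW lt; rewrite nth_default in h.
by rewrite (nth_rcons_eq _ se) !nth_rcons se xd yd => /andP[/eqP ->].
Qed.

Lemma decp_last d x : x < d -> decp d (fun w e => (nth 0 e x).+1 == size w).
Proof.
move=> xd.
have H : decp d.+1 (fun w e => (nth 0 e d == (nth 0 e x).+1) && ~~ (nth 0 e d < size w)).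
  by apply: decp_and; [apply: decp_succ | apply: decp_not; apply: decp_inside]; rewrite // ltnW.
apply: (decp_exists H) => w e se be; split=> [/eqP h|[k [le]]].
  by exists (size w); rewrite (nth_rcons_eq _ se) nth_rcons se xd h eqxx ltnn.
rewrite (nth_rcons_eq _ se) nth_rcons se xd => /andP[/eqP <-].
by rewrite -leqNgt => ge; rewrite eqn_leq le ge.
Qed.

Lemma decp_exists_many d k P : decp (d + k) P ->
  exists2 Q, decp d Q & forall w e, size e = d -> bounded w e ->
    Q w e <-> exists e', [/\ size e' = k, bounded w e' & P w (e ++ e')].
Proof.
elim: k d => [|k IH] d; rewrite ?addn0 => HP.
  exists P => // w e se be; split=> [p|[e' [/size0nil -> _]]]; last by rewrite cats0.
  by exists [::]; rewrite cats0.
rewrite -addSnnS in HP; have [Q HQ QE] := IH _ HP.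
exists (fun w e => has (fun v => Q w (rcons e v)) (iota 0 (size w).+1)).
  exact: decp_ex.
move=> w e se be; split=> [/hasP[v]|[e' []]]; last first.
  case: e' => // v e' [se'] /andP[bv be'] p; apply/hasP; exists v.
    by rewrite mem_iota0.
  apply/QE; [exact: size_rcons_eq | by rewrite bounded_rcons bv|].
  by exists e'; rewrite cat_rcons.
rewrite mem_iota0 ltnS => bv; have sr := size_rcons_eq v se.
case/(QE w _ sr); first by rewrite bounded_rcons bv.
by move=> e' [se' be' p]; exists (v :: e'); rewrite /= se' -cat_rcons bv.
Qed.

Section Accept.
Variable n : nat.
Hypothesis n_gt0 : 0 < n.

(** Allows [p] and [q], functions on all naturals, to be replaced by the finitely many values stored
    in an environment. *)
Lemma accept_ext w m p q lo hi p' q' (lo' hi' : {ffun 'I_n -> bool} -> 'I_n -> nat) :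
  (forall i, i < n + n -> p i = p' i /\ q i = q' i) ->
  (forall t j, lo t j = lo' t j /\ hi t j = hi' t j) ->
  accept w m p q lo hi -> accept w m p' q' lo' hi'.
Proof.
move=> pq lh.
have pE i : i < n + n -> p' i = p i by move/pq => [].
have qE i : i < n + n -> q' i = q i by move/pq => [].
have inn (i : 'I_n) : i < n + n by rewrite ltn_addr.
have prE g : profile n w p' g = profile n w p g.
  by apply/ffunP => i; rewrite !ffunE /bit pE.
have ownE g j : own w p' lo' hi' g j = own w p lo hi g j.
  by rewrite /own prE; have [-> ->] := lh (profile n w p g) j.
have shareE j : share w m p' lo' hi' j = share w m p lo hi j.
  by apply: eq_count => g; rewrite ownE.
have worthE i j : worth w m p' lo' hi' i j = worth w m p lo hi i j.
  by apply: eq_count => g; rewrite ownE /bit pE.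
case/and5P => m0 p0 qN /forallP pS /and5P[/forallP H /forallP rows
  /forallP nums owner /forallP fair].
have lt0 : 0 < n + n by rewrite addn_gt0 n_gt0.
apply/and5P; split; rewrite ?pE ?qE ?ltn_predL //.
  apply/forallP => i; have lti : i.+1 < n + n by rewrite -ltn_predRL ltn_ord.
  by rewrite pE // qE ?pS // ltnW.
apply/and5P; split.
- by apply/forallP => i; rewrite pE ?qE.
- by apply/forallP => i; rewrite pE ?qE.
- by apply/forallP => j; rewrite shareE pE ?qE ?ltn_add2l.
- move: owner; congr (~~ _); apply: eq_has => g; congr (_ && (_ != _)).
  by apply: eq_card => j; rewrite !inE ownE.
- apply/forallP => i; apply/forallP => j; rewrite !worthE.
  by have /forallP := fair i; apply.
Qed.

Let threshold_index : finType := ({ffun 'I_n -> bool} * 'I_n * bool)%type.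
(** Variable 0 is the number of goods, followed by [n + n] block starts and [n + n] closing
    separators; the interval endpoints begin at [base]. *)
Let base := (n + n + (n + n)).+1.
Let dim := base + #|threshold_index|.

Let env_p (e : seq nat) i := nth 0 e i.+1.
Let env_q (e : seq nat) i := nth 0 e (n + n + i).+1.
Let t_index (b : bool) (t : {ffun 'I_n -> bool}) (j : 'I_n) : nat :=
  base + @enum_rank threshold_index (t, j, b).
Let env_t b (e : seq nat) t j := nth 0 e (t_index b t j).

Let t_lt b t j : t_index b t j < dim.
Proof. by rewrite ltn_add2l. Qed.

Let p_lt i : i < n + n -> i.+1 < dim.
Proof. rewrite /dim /base; lia. Qed.

Let q_lt i : i < n + n -> (n + n + i).+1 < dim.
Proof. rewrite /dim /base; lia. Qed.

(** Which endpoint variables matter depends on the type of the good, which is read from the word,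
    while variable indices are fixed in a formula. Hence a conjunction over all types [t]: either
    the good is not of type [t], or it lies in the interval of [t]. *)
Lemma decp_own j : decp dim.+1 (fun w e =>
  own w (env_p (take dim e)) (env_t false (take dim e)) (env_t true (take dim e))
    (nth 0 e dim) j).
Proof.
have B (i : 'I_n) b : decp dim.+1 (fun w e =>
    (nth None w (nth 0 e i.+1 + nth 0 e dim) == Some true) == b).
  apply: decp_eqb; last exact: decp_cst.
  by apply: decp_bit => //; apply/ltnW/p_lt/ltn_addr.
have L t : decp dim.+1 (fun w e => (nth 0 e (t_index false t j) <= nth 0 e dim) &&
      (nth 0 e dim < nth 0 e (t_index true t j))).
  by apply: decp_and; [apply: decp_leq | apply: decp_lt] => //; apply/ltnW/t_lt.
have H (t : {ffun 'I_n -> bool}) :=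
  decp_or (decp_not (decp_forall (fun i => B i (t i)))) (L t).
apply: decp_ext (decp_forall H) => w e se be; rewrite /own /env_t !nth_take //.
have bE (i : 'I_n) : bit w (env_p (take dim e)) i (nth 0 e dim) =
    (nth None w (nth 0 e i.+1 + nth 0 e dim) == Some true).
  by rewrite /bit /env_p nth_take //; apply/p_lt/ltn_addr.
set t0 := profile n w _ _.
apply/forallP/idP => [/(_ t0)|h t].
  rewrite -[X in _ || X]/(_ && _) => /orP[/negP[]|//].
  by apply/forallP => i; rewrite ffunE bE.
case: (eqVneq t t0) => [->|ne]; first by rewrite h orbT.
apply/orP; left; apply: contra ne => /forallP E; apply/eqP/ffunP => i.
by rewrite ffunE bE (eqP (E i)).
Qed.

Lemma decp_accept : decp dim (fun w e =>
  accept w (nth 0 e 0) (env_p e) (env_q e) (env_t false e) (env_t true e)).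
Proof.
have d0 : 0 < dim by [].
have M : decp dim.+1 (fun w e => nth 0 e dim < nth 0 (take dim e) 0).
  apply: decp_ext (@decp_lt dim.+1 dim 0 (ltnSn _) isT) => w e _ _.
  by rewrite nth_take.
have Bit (i : 'I_n) : decp dim.+1 (fun w e => bit w (env_p (take dim e)) i (nth 0 e dim)).
  apply: decp_ext (@decp_bit dim.+1 i.+1 dim _ _) => [w e _ _||//]; last first.
    by apply/ltnW/p_lt/ltn_addr.
  by rewrite /bit /env_p nth_take //; apply/p_lt/ltn_addr.
have Share j : fn dim (fun w e =>
    share w (nth 0 e 0) (env_p e) (env_t false e) (env_t true e) j).
  by apply: fn_count_take; apply: decp_and => //; apply: decp_own.
have Worth i j : fn dim (fun w e =>
    worth w (nth 0 e 0) (env_p e) (env_t false e) (env_t true e) i j).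
  by apply: fn_count_take; apply: decp_and => //; apply: decp_and => //; apply: decp_own.
apply: decp_and.
  apply: decp_ext (decp_not (decp_zero d0)) => w e _ _; by rewrite lt0n.
apply: decp_and; first by apply: decp_zero; apply: p_lt; rewrite addn_gt0 n_gt0.
apply: decp_and; first by apply: decp_last; apply: q_lt; lia.
apply: decp_and.
  apply: decp_forall => i; apply: decp_succ; [apply: q_lt | apply: p_lt];
  by have := ltn_ord i; lia.
apply: decp_and.
  apply: decp_forall => i; apply: decp_and.
    by apply: decp_leq; [apply: p_lt | apply: q_lt].
  by apply: decp_sym; apply: q_lt.
have inn (i : 'I_n) : i < n + n by rewrite ltn_addr.
apply: decp_and.
  apply: decp_forall => i; apply: decp_and.
    by apply: decp_add => //; [apply: p_lt | apply: q_lt].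
  apply: decp_not; apply: decp_has; apply: decp_and; last exact: decp_sym.
  apply: decp_ext (decp_and (@decp_leq dim.+1 i.+1 dim _ _)
    (@decp_lt dim.+1 dim (n + n + i).+1 _ _)).
  - by move=> w e _ _; rewrite /env_p /env_q !nth_take //; [apply: q_lt | apply: p_lt].
  - exact/ltnW/p_lt.
  - by [].
  - by [].
  - exact/ltnW/q_lt.
apply: decp_and.
  apply: decp_forall => j; have ltj : n + j < n + n by rewrite ltn_add2l.
  (* The share of [j] is substituted for a fresh last variable, against which the numeral is
     checked. *)
  have N : decp dim.+1 (fun w e =>
      numeral_check w (nth 0 e (n + j).+1) (nth 0 e (n + n + (n + j)).+1) (nth 0 e dim)).
    by apply: decp_numeral => //; [apply/ltnW/p_lt | apply/ltnW/q_lt].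
  apply: decp_ext (decp_push (Share j) N) => w e se be.
  by rewrite (nth_rcons_eq _ se) !nth_rcons se p_lt // q_lt.
apply: decp_and.
  apply: decp_not; apply: decp_has; apply: decp_and => //.
  (* Having exactly one owner is a Boolean function of the [n] ownership predicates. *)
  have := @decp_bool _ (fun b : {ffun 'I_n -> bool} => #|[set j | b j]| != 1)
    dim.+1 _ decp_own.
  apply: decp_ext => w e _ _; congr (_ != _).
  by apply: eq_card => j; rewrite !inE ffunE.
by apply: decp_forall => i; apply: decp_forall => j; apply: decp_leq_succ.
Qed.

Lemma accept_env w m p q (lo hi : {ffun 'I_n -> bool} -> 'I_n -> nat) :
  m <= size w -> (forall i, i < n + n -> p i <= size w /\ q i <= size w) ->
  (forall t j, lo t j <= size w /\ hi t j <= size w) ->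
  exists e, [/\ size e = dim, bounded w e, nth 0 e 0 = m,
    forall i, i < n + n -> p i = env_p e i /\ q i = env_q e i &
    forall t j, lo t j = env_t false e t j /\ hi t j = env_t true e t j].
Proof.
move=> mw pqw lhw.
pose th (v : threshold_index) := if v.2 then hi v.1.1 v.1.2 else lo v.1.1 v.1.2.
pose e1 := m :: mkseq p (n + n) ++ mkseq q (n + n).
have s1 : size e1 = base by rewrite /= size_cat !size_mkseq.
exists (e1 ++ [seq th v | v <- enum threshold_index]); split.
- by rewrite size_cat s1 size_map -cardE.
- have bf f : (forall i, i < n + n -> f i <= size w) -> bounded w (mkseq f (n + n)).
    by move=> h; apply/allP => x /mapP[i]; rewrite mem_iota0 => /h ? ->.
  rewrite bounded_cat /e1 -cat1s !bounded_cat !bf; try by move=> i /pqw[].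
  rewrite /= mw /=.
  apply/allP => x /mapP[[[t j] b] _ ->]; rewrite /th /=.
  by have [? ?] := lhw t j; case: b.
- by [].
- move=> i lt; rewrite /env_p /env_q !nth_cat s1 /base !ltnS ltn_add2l lt.
  rewrite ltn_addr //= !nth_cat size_mkseq lt ltnNge leq_addr addKn.
  by rewrite /= !nth_mkseq.
have E t j b : env_t b (e1 ++ [seq th v | v <- enum threshold_index]) t j = th (t, j, b).
  rewrite /env_t /t_index nth_cat s1 ltnNge leq_addr addKn.
  by rewrite (nth_map (t, j, b)) -?cardE ?ltn_ord // nth_enum_rank.
by move=> t j; rewrite !E.
Qed.

End Accept.

Theorem theorem3p7 (R : realType) (n : nat) (hn : (2 <= n)%N) :
  in_P (binary_reformability R n).
Proof.
have n0 : 0 < n by apply: ltnW.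
(* Binding all variables of the certificate existentially leaves a closed predicate. *)
have [Q HQ QE] := @decp_exists_many 0 _ _ (decp_accept n0).
apply: decp_in_P HQ _ => w.
rewrite QE //; split=> [[e [_ _ acc]]|/(accept_complete hn)].
  exact: (accept_sound R hn acc).
move=> [m [p [q [lo [hi [mw pqw lhw acc]]]]]].
have [e [se be em epq elh]] := accept_env mw pqw lhw.
exists e; split=> //; rewrite em; exact: (accept_ext n0 epq elh acc).
Qed.
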